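(* Let $G=(X,E)$ be a finite connected graph, let $x\neq y$ be two vertices with graph distance $d=d(x,y)$, and consider the simple double-well potential $W=\chi_{\{x,y\}}$ (i.e. $W(x)=W(y)=1$ and $W(v)=0$ for all other $v$), with Hamiltonian $H=\Delta-QW$. Then, for tunneling from $x$ to $y$ (and likewise from $y$ to $x$): (1) if $co(x,y)\ge d$, there is perfect asymptotic tunneling ($TC(x,y)=1$); (2) if $co(x,y)=d-1$, there is partial tunneling ($0<TC(x,y)<1$); (3) if $co(x,y)<d-1$, there is no tunneling ($TC(x,y)=0$). Moreover, whenever there is tunneling (cases (1) and (2)), the tunneling time is $\Theta(Q^{d-1})$.
   Context: $G=(X,E)$ is a finite connected graph and $d_v$ denotes the degree of $v\in X$. The symmetrized Laplacian $\Delta$ is the $X\times X$ matrix with $\Delta(v,v)=1$, $\Delta(v,w)=-1/\sqrt{d_vd_w}$ if $vw\in E$, and $0$ otherwise. For $W:X\to\mathbb{R}$ (identified with the diagonal matrix) and a real parameter $Q$, the Hamiltonian is $H=\Delta-QW$. For a starting vertex $u$, the state at time $t$ is $\varphi_t=e^{itH}\chi_u$ (the solution of $-i\frac{d}{dt}\varphi_t=H\varphi_t$, $\varphi_0=\chi_u$, where $\chi_u$ is the indicator vector of $u$); it depends on $Q$. The tunneling coefficient from $u$ to $v$ is $TC(u,v)=\liminf_{Q\to\infty}\sup_{t\in[0,\infty)}|\varphi_t(v)|^2$. Perfect tunneling means $TC(u,v)=1$, partial tunneling $0<TC(u,v)<1$, no tunneling $TC(u,v)=0$. Tunneling from $u$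 to $v$ happens within time $f(Q)$ if $TC(u,v)=\liminf_{Q\to\infty}\sup_{t\in[0,f(Q)]}|\varphi_t(v)|^2$; Bachmann–Landau notation is used for tunneling times (e.g. ''tunneling time $\Theta(g(Q))$'': tunneling happens within some time $f(Q)=O(g(Q))$, and not within any time $f(Q)=o(g(Q))$). $PR(v,k)$ denotes the probability that the simple random walk started at $v$ is back at $v$ at time $k$. Two vertices $x,y$ are $m$-cospectral if $PR(x,k)=PR(y,k)$ for all $0\le k\le m$; the cospectrality $co(x,y)$ is the maximal such $m$ (possibly $\infty$). *)

(* Defs.v *)
From HB Require Import structures.
From mathcomp Require Import all_boot all_order all_algebra.
From mathcomp Require Import all_classical all_reals all_analysis.
Set Implicit Arguments. Unset Strict Implicit. Unset Printing Implicit Defensive.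
Import Order.TTheory GRing.Theory Num.Theory.
Local Open Scope classical_set_scope.
Local Open Scope ring_scope.

Section Defs.
Variable R : realType.
Variable T : finType.

Definition simple_graph (e : rel T) : Prop :=
  symmetric e /\ irreflexive e.

Definition connected_graph (e : rel T) : Prop :=
  forall x y : T, connect e x y.

Definition walk_of_length (e : rel T) (x y : T) (n : nat) : Prop :=
  exists p : seq T, [/\ size p = n, path e x p & last x p = y].

Definition graph_dist (e : rel T) (x y : T) (n : nat) : Prop :=
  walk_of_length e x y n /\ forall m, (m < n)%N -> ~ walk_of_length e x y m.

Definition deg (e : rel T) (v : T) : nat := #|[set w | e v w]|.

Definition mmul (A B : T -> T -> R) : T -> T -> R :=
  fun x y => \sum_(z : T) A x z * B z y.
Definition mid : T -> T -> R := fun x y => (x == y)%:R.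
Definition mpow (A : T -> T -> R) (k : nat) : T -> T -> R :=
  iter k (mmul A) mid.

Definition laplacian (e : rel T) : T -> T -> R :=
  fun v w => if v == w then 1
             else if e v w then - (Num.sqrt ((deg e v)%:R * (deg e w)%:R))^-1
             else 0.

Definition hamiltonian (e : rel T) (W : T -> R) (Q : R) : T -> T -> R :=
  fun v w => laplacian e v w - Q * (if v == w then W v else 0).

Definition double_well (x y : T) : T -> R :=
  fun v => ((v == x) || (v == y))%:R.

(* e^{itH} = cos(tH) + i sin(tH) for the real symmetric matrix H, each
   given entrywise by its exponential power series. *)
Definition cosM (H : T -> T -> R) (t : R) (v u : T) : R :=
  limn (fun n => \sum_(0 <= k < n)
         ((-1) ^+ k * t ^+ (2 * k) / (2 * k)`!%:R * mpow H (2 * k) v u)).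
Definition sinM (H : T -> T -> R) (t : R) (v u : T) : R :=
  limn (fun n => \sum_(0 <= k < n)
         ((-1) ^+ k * t ^+ (2 * k).+1 / (2 * k).+1`!%:R * mpow H (2 * k).+1 v u)).

(* |phi_t(v)|^2 where phi_t = e^{itH} chi_u *)
Definition amp2 (H : T -> T -> R) (u v : T) (t : R) : R :=
  cosM H t v u ^+ 2 + sinM H t v u ^+ 2.

Definition liminf_pinfty (f : R -> \bar R) : \bar R :=
  ereal_sup [set ereal_inf [set f Q | Q in [set Q | M <= Q]] | M in [set: R]].

Definition TC (e : rel T) (W : T -> R) (u v : T) : \bar R :=
  liminf_pinfty (fun Q =>
    ereal_sup [set (amp2 (hamiltonian e W Q) u v t)%:E | t in [set t | 0 <= t]]).

Definition tunnels_within (e : rel T) (W : T -> R) (u v : T) (f : R -> R) : Prop :=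
  TC e W u v = liminf_pinfty (fun Q =>
    ereal_sup [set (amp2 (hamiltonian e W Q) u v t)%:E
              | t in [set t | 0 <= t <= f Q]]).

Definition bigO_pinfty (f g : R -> R) : Prop :=
  exists C M : R, forall Q, M <= Q -> `|f Q| <= C * `|g Q|.
Definition littleo_pinfty (f g : R -> R) : Prop :=
  forall eps : R, 0 < eps -> exists M : R, forall Q, M <= Q -> `|f Q| <= eps * `|g Q|.

Definition tunneling_time_Theta (e : rel T) (W : T -> R) (u v : T) (g : R -> R) : Prop :=
  (exists f, bigO_pinfty f g /\ tunnels_within e W u v f) /\
  (forall f, littleo_pinfty f g -> ~ tunnels_within e W u v f).

Definition rw_matrix (e : rel T) : T -> T -> R :=
  fun v w => if e v w then ((deg e v)%:R)^-1 else 0.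
Definition PR (e : rel T) (v : T) (k : nat) : R := mpow (rw_matrix e) k v v.
Definition cospectral (e : rel T) (m : nat) (x y : T) : Prop :=
  forall k, (k <= m)%N -> PR e x k = PR e y k.
End Defs.

(* Main.v *)
(** Write [H = 1 - M] with [M = N + Q W], where [N] is the normalized adjacency
    matrix, so that [N^k(v,v)] is the return probability [PR(v,k)].  Let
    [S(l) = (l - N)^-1].  A vector [p] satisfies [M p = l p] if and only if
    [p = Q S(l) (p(x) chi_x + p(y) chi_y)], which for large [Q] reduces the two
    eigenvalues near [Q] to the 2x2 equation
    [(1/Q - Sxx)(1/Q - Syy) = Sxy^2].  The ratio [r = p(y)/p(x)] solves
    [r - 1/r = kappa] with [kappa = (Syy - Sxx)/Sxy], and the expansion
    [S(l) = sum_k N^k l^(-k-1)] shows that [kappa] tends to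
    [(PR(y,d) - PR(x,d)) / N^d(x,y)] if the return probabilities agree below
    [d], and that it is unbounded otherwise.  All remaining modes carry
    a vanishing part of [chi_x], hence by unitarity, uniformly in [t],
    [|phi_t(y)|^2 = 2 / (kappa^2 + 4) * (1 - cos (gap t)) + o(1)], where
    subtracting the equations for the two eigenvalues gives
    [gap = Theta(Q^(1-d))]. *)
Require Import Defs.
From HB Require Import structures.
From mathcomp Require Import all_boot all_order all_algebra.
From mathcomp Require Import all_classical all_reals all_analysis.
From mathcomp Require Import ring lra.
Set Implicit Arguments. Unset Strict Implicit. Unset Printing Implicit Defensive.
Import Order.TTheory GRing.Theory Num.Theory.
Import numFieldNormedType.Exports.
Local Open Scope classical_set_scope.
Local Open Scope ring_scope.

(** * Inner product, l1 norm and Bessel's inequality for functions on a finite type *)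

Section FiniteVectors.
Variables (R : realType) (T : finType).
Implicit Types (f g h : T -> R) (A : T -> T -> R).

(** For [d > 1] the gap tends to 0, while each eigenvalue is only located within a factor 2 of [Q],
    so the gap cannot be read off as a difference of two approximations. The exact identity [Sxx(l')
    - Sxx(l) = (l - l') <S(l) chi_x, S(l') chi_x>] is used instead. At an eigenvalue
    [1/Q - Sxx = r Sxy], and the two ratios [r] have opposite signs: the subtraction adds two terms
    of size [Q^(-d-1)] without cancellation, and the inner product has size [Q^(-2)]. The relevant
    times are as large as [Q^(d-1)], so all errors must be uniform in [t]. No diagonalization of [H]
    is used for this: the two eigenvalues come from the intermediate value theorem and their
    eigenvectors are explicit. Both eigenvectors have almost all their mass on the wells, which by
    Bessel's inequality leaves only a small part of [chi_x] outside their span; conservation of the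
    norm keeps that part small forever. *)

Definition dot f g : R := \sum_v f v * g v.
Definition app A f : T -> R := fun v => \sum_w A v w * f w.
Definition l1 f : R := \sum_v `|f v|.
Definition entry_sum A : R := \sum_v \sum_w `|A v w|.
Definition chi (u : T) : T -> R := fun v => (v == u)%:R.

Lemma l1_ge0 f : 0 <= l1 f.
Proof. exact: sumr_ge0. Qed.

Lemma entry_sum_ge0 A : 0 <= entry_sum A.
Proof. by apply: sumr_ge0 => v _; apply: sumr_ge0. Qed.

Lemma norm_le_l1 f v : `|f v| <= l1 f.
Proof. by rewrite /l1 (bigD1 v)//= lerDl sumr_ge0. Qed.

Lemma l1_app A f : l1 (app A f) <= entry_sum A * l1 f.
Proof.
rewrite /entry_sum mulr_suml; apply: ler_sum => v _.
apply: le_trans (ler_norm_sum _ _ _) _; rewrite mulr_suml.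
by apply: ler_sum => w _; rewrite normrM ler_wpM2l ?norm_le_l1.
Qed.

Lemma norm_dot_le f g : `|dot f g| <= l1 f * l1 g.
Proof.
apply: le_trans (ler_norm_sum _ _ _) _; rewrite /l1 mulr_suml.
by apply: ler_sum => v _; rewrite normrM ler_wpM2l ?norm_le_l1.
Qed.

Lemma l1_chi u : l1 (chi u) = 1.
Proof.
rewrite /l1 (bigD1 u)//= /chi eqxx normr1 big1 ?addr0// => v /negbTE ->.
by rewrite normr0.
Qed.

Lemma dotC f g : dot f g = dot g f.
Proof. by apply: eq_bigr => v _; rewrite mulrC. Qed.

Lemma dot_chil u f : dot (chi u) f = f u.
Proof.
rewrite /dot (bigD1 u)//= /chi eqxx mul1r big1 ?addr0// => v /negbTE ->.
by rewrite mul0r.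
Qed.

Lemma dot_ge0 f : 0 <= dot f f.
Proof. by apply: sumr_ge0 => v _; rewrite -expr2 sqr_ge0. Qed.

Lemma dotDr f g h : dot f (fun v => g v + h v) = dot f g + dot f h.
Proof. by rewrite /dot -big_split; apply: eq_bigr => v _; rewrite mulrDr. Qed.

Lemma dotZr c f g : dot f (fun v => c * g v) = c * dot f g.
Proof. by rewrite /dot mulr_sumr; apply: eq_bigr => v _; rewrite mulrCA. Qed.

Lemma dotDl f g h : dot (fun v => g v + h v) f = dot g f + dot h f.
Proof. by rewrite !(dotC _ f) dotDr. Qed.

Lemma dotZl c f g : dot (fun v => c * g v) f = c * dot g f.
Proof. by rewrite !(dotC _ f) dotZr. Qed.

Lemma sqr_le_dot f v : f v ^+ 2 <= dot f f.
Proof.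
rewrite /dot (bigD1 v)//= expr2 lerDl; apply: sumr_ge0 => w _.
by rewrite -expr2 sqr_ge0.
Qed.

Lemma appD A f g v : app A (fun w => f w + g w) v = app A f v + app A g v.
Proof. by rewrite /app -big_split; apply: eq_bigr => w _; rewrite mulrDr. Qed.

Lemma appZ A c f v : app A (fun w => c * f w) v = c * app A f v.
Proof. by rewrite /app mulr_sumr; apply: eq_bigr => w _; rewrite mulrCA. Qed.

Lemma dot_app_sym A f g : (forall v w, A v w = A w v) ->
  dot f (app A g) = dot (app A f) g.
Proof.
move=> As; rewrite /dot /app.
under eq_bigr do rewrite mulr_sumr.
rewrite exchange_big /=; apply: eq_bigr => v _.
by rewrite mulr_suml; apply: eq_bigr => w _; rewrite (As v w); ring.
Qed.

Lemma bessel2 (p q f : T -> R) : dot p p = 1 -> dot q q = 1 -> dot p q = 0 ->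
  dot f p ^+ 2 + dot f q ^+ 2 <= dot f f.
Proof.
move=> p1 q1 pq.
have := dot_ge0 (fun v => f v + ((- dot f p) * p v + (- dot f q) * q v)).
rewrite !(dotDl, dotDr, dotZl, dotZr) p1 q1 (dotC q p) pq (dotC p f) (dotC q f).
by move=> H; nra.
Qed.

Lemma app_onto A : (forall f, (forall v, app A f v = 0) -> forall v, f v = 0) ->
  forall b, exists f, forall v, app A f v = b v.
Proof.
move=> inj b.
(* [M] is the transpose of [A] along [enum_val]: [app A] becomes [u *m M] on row vectors, and
   injectivity becomes row freeness. *)
pose M := \matrix_(i < #|T|, j < #|T|) A (enum_val j) (enum_val i).
have appM (u : 'rV[R]_#|T|) v :
    app A (fun w => u 0 (enum_rank w)) v = (u *m M) 0 (enum_rank v).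
  rewrite /app (reindex_omap enum_val (fun w => Some (enum_rank w))) /=; last first.
    by move=> w _; rewrite enum_rankK.
  rewrite !mxE; apply: eq_big => [i|i _]; first by rewrite enum_valK eqxx.
  by rewrite !mxE enum_rankK enum_valK mulrC.
have Mu : M \in unitmx.
  rewrite -row_free_unit -kermx_eq0; apply/rowV0P => u /sub_kermxP uM.
  apply/rowP => i; rewrite mxE -[i]enum_valK.
  by apply: (inj (fun w => u 0 (enum_rank w))) => v; rewrite appM uM mxE.
exists (fun w => ((\row_i b (enum_val i)) *m invmx M) 0 (enum_rank w)) => v.
by rewrite appM mulmxKV// mxE enum_rankK.
Qed.

End FiniteVectors.

(** * Exponential generating functions and their derivatives *)

Section ExponentialGeneratingFunctions.
Variable R : realType.
Implicit Types b c : nat -> R.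

(** Differentiation merely shifts [b]. For [b k] a sign times [H^k f], this turns the power series
    of the cosine and sine of [tH] into solutions of a linear differential equation. *)
Definition egf b (x : R) : R := limn (pseries (fun k => b k / k`!%:R) x).

Definition exp_bounded b := exists B L : R, forall k, `|b k| <= B * L ^+ k.

Lemma exp_bounded_ge0 b : exp_bounded b ->
  exists B L : R, [/\ 0 <= B, 0 <= L & forall k, `|b k| <= B * L ^+ k].
Proof.
move=> [B [L bBL]]; exists `|B|, `|L|; split=> // k.
by apply: le_trans (bBL k) _; rewrite -normrX -normrM ler_norm.
Qed.

Lemma is_cvg_egf b x : exp_bounded b ->
  cvgn (pseries (fun k => b k / k`!%:R) x).
Proof.
move=> /exp_bounded_ge0[B [L [B0 L0 bBL]]]; apply: normed_cvg.
apply: (@series_le_cvg _ _ (fun k => B * exp_coeff (L * `|x|) k)).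
- by move=> n; rewrite normr_ge0.
- by move=> n; rewrite mulr_ge0// /exp_coeff divr_ge0// exprn_ge0// mulr_ge0.
- move=> n; rewrite /exp_coeff /= !normrM normfV normr_nat normrX exprMn.
  rewrite [leLHS](_ : _ = `|b n| * (`|x| ^+ n / n`!%:R)); last by ring.
  rewrite [leRHS](_ : _ = (B * L ^+ n) * (`|x| ^+ n / n`!%:R)); last by ring.
  by rewrite ler_wpM2r// divr_ge0// exprn_ge0.
- have -> : series (fun k => B * exp_coeff (L * `|x|) k) =
            (fun n => B * series (exp_coeff (L * `|x|)) n).
    by apply/funext => n; rewrite /series /= mulr_sumr.
  by apply: is_cvgMr; exact: is_cvg_series_exp_coeff.
Qed.

Lemma cvg_egf b x : exp_bounded b ->
  pseries (fun k => b k / k`!%:R) x @ \oo --> egf b x.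
Proof. exact: is_cvg_egf. Qed.

Lemma exp_bounded_shift b : exp_bounded b -> exp_bounded (fun k => b k.+1).
Proof.
move=> [B [L bBL]]; exists (B * L), L => k.
by rewrite -mulrA -exprS.
Qed.

Lemma pseries_diffs_egf b : pseries_diffs (fun k => b k / k`!%:R) =
  (fun k => b k.+1 / k`!%:R).
Proof.
apply/funext => k; rewrite /pseries_diffs factS natrM invfM.
by rewrite mulrCA (mulrA k.+1%:R) divff ?pnatr_eq0// mul1r.
Qed.

Lemma is_derive_egf b (x : R) : exp_bounded b ->
  is_derive x (1 : R) (egf b) (egf (fun k => b k.+1) x).
Proof.
move=> bb; have bb1 := exp_bounded_shift bb; have bb2 := exp_bounded_shift bb1.
(* Convergence of the series and of its two formal derivatives is supplied at [|x| + 1], strictly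
   beyond [x]. *)
have := @pseries_snd_diffs _ (fun k => b k / k`!%:R) (`|x| + 1) x.
rewrite !pseries_diffs_egf; apply; try exact: is_cvg_egf.
by rewrite [ltRHS]ger0_norm ?addr_ge0// ltrDl.
Qed.

Lemma egf_lin_sum (I : finType) (c : I -> R) (b : I -> nat -> R) x :
  (forall i, exp_bounded (b i)) ->
  egf (fun k => \sum_i c i * b i k) x = \sum_i c i * egf (b i) x.
Proof.
move=> bb; apply: cvg_lim => //.
have -> : pseries (fun k => (\sum_i c i * b i k) / k`!%:R) x =
    (fun n => \sum_i c i * pseries (fun k => b i k / k`!%:R) x n).
  apply/funext => n; rewrite /pseries /series /=.
  under [RHS]eq_bigr do rewrite mulr_sumr.
  rewrite exchange_big /=; apply: eq_bigr => k _.
  by rewrite !mulr_suml; apply: eq_bigr => i _; ring.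
elim: (index_enum I) => [|i s IH].
  rewrite big_nil; under eq_fun do rewrite big_nil; exact: cvg_cst.
rewrite big_cons; under eq_fun do rewrite big_cons.
by apply: cvgD => //; apply: cvgMr; exact: cvg_egf.
Qed.

Lemma egf0 b : egf b 0 = b 0%N.
Proof.
apply: cvg_lim => //; rewrite -cvg_shiftS /=.
rewrite [X in X @ _ --> _](_ : _ = fun=> b 0%N); first exact: cvg_cst.
apply/funext => n; rewrite /pseries /series /= big_nat_recl//= expr0 fact0.
rewrite divr1 mulr1 big1 ?addr0// => k _.
by rewrite expr0n mulr0.
Qed.

End ExponentialGeneratingFunctions.

(** * Cosine and sine of [tH], their differential equations and conservation of the norm *)

Section Evolution.
Variables (R : realType) (T : finType) (H : T -> T -> R).
Hypothesis Hsym : forall v w, H v w = H w v.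
Implicit Types (f g : T -> R) (t : R) (v : T).

(** Coefficients for all indices, zero at the wrong parity, so that one shift exchanges cosine and
    sine. The [k.-1] in [sin_sign] makes [sin_signS] hold by computation. *)
Definition cos_sign k : R := (~~ odd k)%:R * (-1) ^+ k./2.
Definition sin_sign k : R := (odd k)%:R * (-1) ^+ k.-1./2.

Lemma cos_signS k : cos_sign k.+1 = - sin_sign k.
Proof.
rewrite /cos_sign /sin_sign /= negbK; case: k => [|k] /=; first by rewrite !mul0r oppr0.
by rewrite exprS; ring.
Qed.

Lemma sin_signS k : sin_sign k.+1 = cos_sign k.
Proof. by []. Qed.

Definition cos_vec f t v := egf (fun k => cos_sign k * iter k (app H) f v) t.
Definition sin_vec f t v := egf (fun k => sin_sign k * iter k (app H) f v) t.

Lemma norm_cos_sign k : `|cos_sign k| <= 1.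
Proof. by rewrite normrM normrX normrN1 expr1n mulr1 normr_nat; case: odd. Qed.

Lemma norm_sin_sign k : `|sin_sign k| <= 1.
Proof. by rewrite normrM normrX normrN1 expr1n mulr1 normr_nat; case: odd. Qed.

Lemma l1_iter_app f k : l1 (iter k (app H) f) <= l1 f * entry_sum H ^+ k.
Proof.
elim: k => [|k IH]; first by rewrite expr0 mulr1.
rewrite iterS; apply: le_trans (l1_app _ _) _.
by rewrite exprS mulrCA ler_wpM2l// entry_sum_ge0.
Qed.

Lemma exp_bounded_iter (s : nat -> R) f v : (forall k, `|s k| <= 1) ->
  exp_bounded (fun k => s k * iter k (app H) f v).
Proof.
move=> s1; exists (l1 f), (entry_sum H) => k; rewrite normrM.
apply: le_trans (l1_iter_app f k); rewrite -[leRHS]mul1r.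
by apply: ler_pM => //; exact: norm_le_l1.
Qed.

Lemma iter_app_shift f k v : iter k.+1 (app H) f v =
  \sum_w H v w * iter k (app H) f w.
Proof. by rewrite iterS. Qed.

Lemma is_derive_cos_vec f t v :
  is_derive t (1 : R) (fun t => cos_vec f t v) (- app H (sin_vec f t) v).
Proof.
have E := @is_derive_egf R _ t (exp_bounded_iter f v norm_cos_sign).
apply: (is_derive_eq E).
rewrite /app -sumrN.
under [RHS]eq_bigr do rewrite -mulNr.
rewrite -egf_lin_sum; last first.
  by move=> w; apply: exp_bounded_iter; exact: norm_sin_sign.
congr egf; apply/funext => k; rewrite cos_signS iter_app_shift mulr_sumr.
by apply: eq_bigr => w _; ring.
Qed.

Lemma is_derive_sin_vec f t v :
  is_derive t (1 : R) (fun t => sin_vec f t v) (app H (cos_vec f t) v).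
Proof.
have E := @is_derive_egf R _ t (exp_bounded_iter f v norm_sin_sign).
apply: (is_derive_eq E).
rewrite /app -egf_lin_sum; last first.
  by move=> w; apply: exp_bounded_iter; exact: norm_cos_sign.
congr egf; apply/funext => k; rewrite sin_signS iter_app_shift mulr_sumr.
by apply: eq_bigr => w _; ring.
Qed.

(** The derivative is [2 (<sin, H cos> - <cos, H sin>)], which the symmetry of [H] cancels. This is
    the unitarity of the evolution. *)
Lemma is_derive_energy f t :
  is_derive t (1 : R) (fun t => dot (cos_vec f t) (cos_vec f t) +
                          dot (sin_vec f t) (sin_vec f t)) 0.
Proof.
have D v : is_derive t (1 : R)
    (fun t => cos_vec f t v * cos_vec f t v + sin_vec f t v * sin_vec f t v)
    (2 * (sin_vec f t v * app H (cos_vec f t) v -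
          cos_vec f t v * app H (sin_vec f t) v)).
  have Dc := is_derive_cos_vec f t v; have Ds := is_derive_sin_vec f t v.
  apply: is_derive_eq; rewrite /GRing.scale /=; ring.
have S (s : seq T) : is_derive t (1 : R)
    (fun t => \sum_(v <- s)
      (cos_vec f t v * cos_vec f t v + sin_vec f t v * sin_vec f t v))
    (\sum_(v <- s) (2 * (sin_vec f t v * app H (cos_vec f t) v -
          cos_vec f t v * app H (sin_vec f t) v))).
  elim: s => [|v s IH].
    by rewrite big_nil; under eq_fun do rewrite big_nil; exact: is_derive_cst.
  by rewrite big_cons; under eq_fun do rewrite big_cons; exact: is_deriveD.
have -> : (fun t => dot (cos_vec f t) (cos_vec f t) +
                    dot (sin_vec f t) (sin_vec f t)) =
    (fun t => \sum_v
      (cos_vec f t v * cos_vec f t v + sin_vec f t v * sin_vec f t v)).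
  by apply/funext => s; rewrite /dot -big_split.
apply: (is_derive_eq (S _)).
rewrite -mulr_sumr sumrB.
have := dot_app_sym (sin_vec f t) (cos_vec f t) Hsym.
rewrite dotC [X in _ = X]dotC /dot => E.
under eq_bigr do rewrite mulrC.
by rewrite E subrr mulr0.
Qed.

Lemma energy_conserved f t : dot (cos_vec f t) (cos_vec f t) +
  dot (sin_vec f t) (sin_vec f t) = dot f f.
Proof.
have E := @is_derive_0_is_cst R (fun t => dot (cos_vec f t) (cos_vec f t) +
  dot (sin_vec f t) (sin_vec f t)) t 0 (is_derive_energy f).
rewrite /= in E; rewrite E.
have -> : cos_vec f 0 = f.
  by apply/funext => v; rewrite /cos_vec egf0 /cos_sign /= expr0 !mul1r.
have -> : sin_vec f 0 = fun=> 0.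
  by apply/funext => v; rewrite /sin_vec egf0 /sin_sign /= !mul0r.
by rewrite [X in _ + X]/dot big1 ?addr0// => v _; rewrite mul0r.
Qed.

Lemma iter_app_lin (I : finType) (c : I -> R) (F : I -> T -> R) k v :
  iter k (app H) (fun w => \sum_i c i * F i w) v =
  \sum_i c i * iter k (app H) (F i) v.
Proof.
elim: k v => //= k IH v; rewrite {1}/app.
under [LHS]eq_bigr do rewrite IH mulr_sumr.
rewrite exchange_big /=; apply: eq_bigr => i _.
by rewrite /app mulr_sumr; apply: eq_bigr => w _; ring.
Qed.

Lemma egf_iter_lin (s : nat -> R) (I : finType) (c : I -> R) (F : I -> T -> R) t v :
  (forall k, `|s k| <= 1) ->
  egf (fun k => s k * iter k (app H) (fun w => \sum_i c i * F i w) v) t =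
  \sum_i c i * egf (fun k => s k * iter k (app H) (F i) v) t.
Proof.
move=> s1; rewrite -egf_lin_sum; last by move=> i; exact: exp_bounded_iter.
congr egf; apply/funext => k; rewrite iter_app_lin mulr_sumr.
by apply: eq_bigr => i _; ring.
Qed.

Lemma iter_app_eigen f m k v : (forall v, app H f v = m * f v) ->
  iter k (app H) f v = m ^+ k * f v.
Proof.
move=> Hf; elim: k v => [|k IH] v; first by rewrite expr0 mul1r.
rewrite iterS; have -> : iter k (app H) f = (fun w => m ^+ k * f w).
  exact/funext.
by rewrite appZ Hf exprSr mulrA.
Qed.

Lemma cos_vec_eigen f m t v : (forall v, app H f v = m * f v) ->
  cos_vec f t v = cos (m * t) * f v.
Proof.
move=> Hf; apply: cvg_lim => //.
have -> : pseries (fun k => cos_sign k * iter k (app H) f v / k`!%:R) t =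
    (fun n => series (cos_coeff (m * t)) n * f v).
  apply/funext => n; rewrite /pseries /series /= mulr_suml.
  apply: eq_bigr => k _; rewrite (iter_app_eigen _ _ Hf) /cos_coeff /= exprMn -?exprnP.
  by rewrite /cos_sign; ring.
apply: cvgMl; rewrite cos.unlock; exact: is_cvg_series_cos_coeff.
Qed.

Lemma sin_vec_eigen f m t v : (forall v, app H f v = m * f v) ->
  sin_vec f t v = sin (m * t) * f v.
Proof.
move=> Hf; apply: cvg_lim => //.
have -> : pseries (fun k => sin_sign k * iter k (app H) f v / k`!%:R) t =
    (fun n => series (sin_coeff (m * t)) n * f v).
  apply/funext => n; rewrite /pseries /series /= mulr_suml.
  apply: eq_bigr => k _; rewrite (iter_app_eigen _ _ Hf) /sin_coeff /= exprMn -?exprnP.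
  by rewrite /sin_sign; ring.
apply: cvgMl; rewrite sin.unlock; exact: is_cvg_series_sin_coeff.
Qed.

Lemma mpow_iter u v k : mpow H k v u = iter k (app H) (chi R u) v.
Proof.
by elim: k v => [|k IH] v //=; apply: eq_bigr => z _; rewrite -IH.
Qed.

Let sum_pair (F : nat -> R) n :
  \sum_(n * 2 <= i < n.+1 * 2) F i = F n.*2 + F n.*2.+1.
Proof. by rewrite !muln2 doubleS big_nat_recr ?leqnSn//= big_nat1. Qed.

(** [cosM] sums even powers only. Grouping the full series into consecutive pairs gives the same
    terms, because one member of each pair vanishes. *)
Lemma cosM_cos_vec t u v : cosM H t v u = cos_vec (chi R u) t v.
Proof.
have := is_cvg_egf (x := t) (exp_bounded_iter (chi R u) v norm_cos_sign).
move=> /(@cvg_series_cvg_series_group _ _ 2) /(_ isT) C.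
apply: cvg_lim => //; apply: cvg_trans C.
rewrite [X in _ --> series X @ \oo](_ : _ = (fun k =>
  (-1) ^+ k * t ^+ (2 * k) / (2 * k)`!%:R * mpow H (2 * k) v u)) //.
apply/funext => n; have cs0 : cos_sign n.*2.+1 = 0.
  by rewrite /cos_sign oddS odd_double mul0r.
rewrite /= sum_pair cs0 !mul0r addr0.
by rewrite -mpow_iter mul2n /cos_sign odd_double doubleK /=; ring.
Qed.

Lemma sinM_sin_vec t u v : sinM H t v u = sin_vec (chi R u) t v.
Proof.
have := is_cvg_egf (x := t) (exp_bounded_iter (chi R u) v norm_sin_sign).
move=> /(@cvg_series_cvg_series_group _ _ 2) /(_ isT) C.
apply: cvg_lim => //; apply: cvg_trans C.
rewrite [X in _ --> series X @ \oo](_ : _ = (fun k =>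
  (-1) ^+ k * t ^+ (2 * k).+1 / (2 * k).+1`!%:R * mpow H (2 * k).+1 v u)) //.
apply/funext => n; have ss0 : sin_sign n.*2 = 0.
  by rewrite /sin_sign odd_double mul0r.
rewrite /= sum_pair ss0 !mul0r add0r.
by rewrite -mpow_iter mul2n /sin_sign oddS odd_double /= doubleK; ring.
Qed.

Lemma mpow_sym k v w : mpow H k v w = mpow H k w v.
Proof.
have P j (f : T -> R) : dot (chi R v) (iter j (app H) f) =
    dot (iter j (app H) (chi R v)) f.
  elim: j f => // j IH f.
  by rewrite iterSr IH dot_app_sym// iterS.
by rewrite !mpow_iter -(dot_chil v) P dotC dot_chil.
Qed.

Lemma amp2_sym u v t : amp2 H u v t = amp2 H v u t.
Proof.
by rewrite /amp2; congr (_ ^+ 2 + _ ^+ 2); congr (limn _); apply/funext => n;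
  apply: eq_bigr => k _; rewrite mpow_sym.
Qed.

End Evolution.

(** * Dynamics governed by two eigenvectors concentrated on two vertices *)

Section TwoModes.
Variables (R : realType) (T : finType) (H : T -> T -> R).
Hypothesis Hsym : forall v w, H v w = H w v.
Implicit Types (f g : T -> R) (t : R) (v : T).

Lemma cos_vecDZ c f g t v : cos_vec H (fun w => f w + c * g w) t v =
  cos_vec H f t v + c * cos_vec H g t v.
Proof.
pose cb (b : bool) := if b then 1 else c; pose fb (b : bool) := if b then f else g.
have -> : (fun w => f w + c * g w) = (fun w => \sum_b cb b * fb b w).
  by apply/funext => w; rewrite big_bool /= mul1r.
rewrite /cos_vec egf_iter_lin; last exact: norm_cos_sign.
by rewrite big_bool /= mul1r.
Qed.

Lemma sin_vecDZ c f g t v : sin_vec H (fun w => f w + c * g w) t v =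
  sin_vec H f t v + c * sin_vec H g t v.
Proof.
pose cb (b : bool) := if b then 1 else c; pose fb (b : bool) := if b then f else g.
have -> : (fun w => f w + c * g w) = (fun w => \sum_b cb b * fb b w).
  by apply/funext => w; rewrite big_bool /= mul1r.
rewrite /sin_vec egf_iter_lin; last exact: norm_sin_sign.
by rewrite big_bool /= mul1r.
Qed.

Lemma half_sqr_product (a b : R) : a ^+ 2 + b ^+ 2 <= 1 -> `|a * b| <= 2^-1.
Proof.
move=> ab; rewrite ler_norml; have := sqr_ge0 (a + b); have := sqr_ge0 (a - b).
by move=> ? ?; apply/andP; split; nra.
Qed.

(** Up to a remainder, the state at [y] is [P e^(imt) + P' e^(int)] with [P = p x * p y] and
    [P' = q x * q y]. Orthogonality of [chi_x] and [chi_y] forces [P'] to be close to [-P], and the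
    squared modulus becomes [2 P^2 (1 - cos)]. *)
Lemma two_mode_estimate (x y : T) (p q : T -> R) (m n delta t : R) :
  x != y ->
  (forall v, app H p v = m * p v) -> (forall v, app H q v = n * q v) ->
  dot p p = 1 -> dot q q = 1 -> dot p q = 0 -> 0 < delta <= 1 ->
  1 - delta ^+ 2 / 2 <= p x ^+ 2 + p y ^+ 2 ->
  1 - delta ^+ 2 / 2 <= q x ^+ 2 + q y ^+ 2 ->
  `|amp2 H x y t - 2 * (p x * p y) ^+ 2 * (1 - cos (m * t - n * t))| <= 7 * delta.
Proof.
move=> xy Hp Hq p1 q1 pq /andP[d0 d1] pw qw.
set a := p x in pw *; set b := p y in pw *.
set a' := q x in qw *; set b' := q y in qw *.
pose rho v := chi R x v + (- a) * p v + (- a') * q v.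
have chixx : chi R x x = 1 by rewrite /chi eqxx.
have chixy : chi R x y = 0 by rewrite /chi eq_sym (negbTE xy).
have B f : dot f p ^+ 2 + dot f q ^+ 2 <= dot f f by exact: bessel2.
have Bx : a ^+ 2 + a' ^+ 2 <= 1.
  by have := B (chi R x); rewrite !dot_chil chixx.
have By : b ^+ 2 + b' ^+ 2 <= 1.
  by have := B (chi R y); rewrite !dot_chil {1}/chi eqxx.
(* Used at [c = 1] and [c = -1]: the four squares sum to nearly 2, so the cross term [a b + a' b']
   is squeezed from both sides. *)
have Bp c : (a + c * b) ^+ 2 + (a' + c * b') ^+ 2 <= 1 + c ^+ 2.
  have := B (fun v => chi R x v + c * chi R y v).
  rewrite !(dotDl, dotDr, dotZl, dotZr, dot_chil) chixx chixy /chi eqxx.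
  by rewrite (negbTE xy) mulr0 addr0 mulr1 add0r -expr2.
(* Adding [pw] and [qw] and subtracting [By] leaves [a^2 + a'^2 >= 1 - delta^2]. *)
have rho2 : dot rho rho <= delta ^+ 2.
  rewrite /rho !(dotDl, dotDr, dotZl, dotZr) p1 q1 pq (dotC q p) pq.
  rewrite !(dotC _ (chi R x)) !dot_chil chixx -/a -/a'.
  by nra.
have decomp : chi R x = (fun v => (rho v + a * p v) + a' * q v).
  by apply/funext => v; rewrite /rho; ring.
clearbody rho.
have energy := energy_conserved Hsym rho t.
have cle := sqr_le_dot (cos_vec H rho t) y.
have sle := sqr_le_dot (sin_vec H rho t) y.
rewrite /amp2 cosM_cos_vec sinM_sin_vec decomp !(cos_vecDZ, sin_vecDZ).
rewrite (cos_vec_eigen _ _ Hp) (cos_vec_eigen _ _ Hq).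
rewrite (sin_vec_eigen _ _ Hp) (sin_vec_eigen _ _ Hq) cosB -/b -/b'.
have := cos2Dsin2 (m * t); have := cos2Dsin2 (n * t).
have := cos_max (m * t); have := cos_max (n * t).
have := sin_max (m * t); have := sin_max (n * t).
have := cos_max (m * t - n * t); rewrite cosB.
move: (cos (m * t)) (cos (n * t)) (sin (m * t)) (sin (n * t)) => c c' s s'.
move=> CC ns' ns nc' nc e' e.
have Xd : `|cos_vec H rho t y| <= delta.
  rewrite -ler_sqr ?nnegrE ?normr_ge0 ?(ltW d0)// real_normK ?num_real//.
  by have := dot_ge0 (sin_vec H rho t); lra.
have Yd : `|sin_vec H rho t y| <= delta.
  rewrite -ler_sqr ?nnegrE ?normr_ge0 ?(ltW d0)// real_normK ?num_real//.
  by have := dot_ge0 (cos_vec H rho t); lra.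
have XY : cos_vec H rho t y ^+ 2 + sin_vec H rho t y ^+ 2 <= delta ^+ 2 by lra.
move: (cos_vec H rho t y) (sin_vec H rho t y) Xd Yd XY => X Y Xd Yd XY.
have pab : `|a * b| <= 2^-1.
  apply: half_sqr_product; rewrite -p1 /dot (bigD1 x)//= (bigD1 y) ?(eq_sym y)//=.
  rewrite !expr2 addrA lerDl; apply: sumr_ge0 => v _; rewrite -expr2; exact: sqr_ge0.
have qab : `|a' * b'| <= 2^-1.
  apply: half_sqr_product; rewrite -q1 /dot (bigD1 x)//= (bigD1 y) ?(eq_sym y)//=.
  rewrite !expr2 addrA lerDl; apply: sumr_ge0 => v _; rewrite -expr2; exact: sqr_ge0.
have eta : `|a * b + a' * b'| <= delta ^+ 2 / 2.
  by rewrite ler_norml; have := Bp 1; have := Bp (-1); nra.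
rewrite !(mulrCA a) !(mulrCA a').
move: eta pab qab.
move: (a * b) (a' * b') => P P' eta pab qab.
have Zc : `|P * c + P' * c'| <= 1.
  apply: le_trans (ler_normD _ _) _; rewrite !normrM.
  by have := normr_ge0 P; have := normr_ge0 P'; nra.
have Zs : `|P * s + P' * s'| <= 1.
  apply: le_trans (ler_normD _ _) _; rewrite !normrM.
  by have := normr_ge0 P; have := normr_ge0 P'; nra.
(* The terms with [X] and [Y] come from the remainder and cost [delta^2 + 4 delta]; the last group
   is the price of replacing [P'] by [-P] and costs at most [3/2 delta^2]. The total is below
   [7 delta]. *)
rewrite (_ : _ - _ = (X ^+ 2 + Y ^+ 2) + 2 * (X * (P * c + P' * c')) +
   2 * (Y * (P * s + P' * s')) + ((P + P') ^+ 2 - 2 * P * (P + P') *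
     (1 - (c * c' + s * s')))); last first.
  suff -> : (X + c * P + c' * P') ^+ 2 + (Y + s * P + s' * P') ^+ 2 =
    X ^+ 2 + Y ^+ 2 + 2 * (X * (P * c + P' * c')) + 2 * (Y * (P * s + P' * s')) +
    P ^+ 2 * (c ^+ 2 + s ^+ 2) + P' ^+ 2 * (c' ^+ 2 + s' ^+ 2) +
    2 * P * P' * (c * c' + s * s') by rewrite e e'; ring.
  by ring.
have T2 : `|2 * (X * (P * c + P' * c'))| <= 2 * delta.
  rewrite normrM ger0_norm// ler_pM2l// normrM -[leRHS]mulr1.
  by apply: ler_pM.
have T3 : `|2 * (Y * (P * s + P' * s'))| <= 2 * delta.
  rewrite normrM ger0_norm// ler_pM2l// normrM -[leRHS]mulr1.
  by apply: ler_pM.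
have T4 : `|(P + P') ^+ 2| <= delta ^+ 2 / 2.
  rewrite normrX; apply: le_trans eta; rewrite expr2 -[leRHS]mulr1 ler_wpM2l//.
  by apply: le_trans (ler_normD _ _) _; lra.
have T5 : `|2 * P * (P + P') * (1 - (c * c' + s * s'))| <= delta ^+ 2.
  rewrite normrM (_ : delta ^+ 2 = delta ^+ 2 / 2 * 2); last by field.
  apply: ler_pM => //.
    rewrite normrM -[leRHS]mul1r ler_pM// normrM ger0_norm//; lra.
  by apply: le_trans (ler_normB _ _) _; rewrite normr1; lra.
have XY0 : 0 <= X ^+ 2 + Y ^+ 2 by rewrite addr_ge0// sqr_ge0.
have dd : delta ^+ 2 <= delta by rewrite expr2 -[leRHS]mulr1 ler_wpM2l// ltW.
move: T2 T3 T4 T5; rewrite !ler_norml => /andP[? ?] /andP[? ?] /andP[? ?] /andP[? ?].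
by apply/andP; split; lra.
Qed.

Lemma two_mode_ratio (x y : T) (p q : T -> R) (m n delta t r kap : R) :
  x != y ->
  (forall v, app H p v = m * p v) -> (forall v, app H q v = n * q v) ->
  dot p p = 1 -> dot q q = 1 -> dot p q = 0 -> 0 < delta <= 1 ->
  1 - delta ^+ 2 / 2 <= p x ^+ 2 + p y ^+ 2 ->
  1 - delta ^+ 2 / 2 <= q x ^+ 2 + q y ^+ 2 ->
  p y = r * p x -> r ^+ 2 - 1 = kap * r ->
  `|amp2 H x y t - 2 / (kap ^+ 2 + 4) * (1 - cos (m * t - n * t))| <= 8 * delta.
Proof.
move=> xy Hp Hq p1 q1 pq d01 pw qw py rk.
have /andP[d0 d1] := d01.
have E := two_mode_estimate t xy Hp Hq p1 q1 pq d01 pw qw.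
have s1 : p x ^+ 2 + p y ^+ 2 <= 1.
  rewrite -p1 /dot (bigD1 x)//= (bigD1 y) ?(eq_sym y)//=.
  rewrite !expr2 addrA lerDl; apply: sumr_ge0 => v _; rewrite -expr2; exact: sqr_ge0.
have k4 : 0 < kap ^+ 2 + 4 by have := sqr_ge0 kap; lra.
(* Since [(r^2 - 1)^2 + 4 r^2 = (r^2 + 1)^2], the left side is the square of the mass on the two
   wells. *)
have kp : (p x * p y) ^+ 2 * (kap ^+ 2 + 4) = (p x ^+ 2 + p y ^+ 2) ^+ 2.
  rewrite py; transitivity (p x ^+ 4 * ((kap * r) ^+ 2 + 4 * r ^+ 2)); first by ring.
  by rewrite -rk; ring.
set s := p x ^+ 2 + p y ^+ 2 in pw s1 kp *.
have P2 : (p x * p y) ^+ 2 = s ^+ 2 / (kap ^+ 2 + 4) by rewrite -kp mulfK ?gt_eqF.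
have dd : delta ^+ 2 <= delta by rewrite expr2 -[leRHS]mulr1 ler_wpM2l// ltW.
have s0 : 0 <= s by lra.
have i4 : (kap ^+ 2 + 4)^-1 <= 4^-1.
  by rewrite lef_pV2 ?posrE//; have := sqr_ge0 kap; lra.
have i0 : 0 <= (kap ^+ 2 + 4)^-1 by rewrite invr_ge0 ltW.
have := cos_max (m * t - n * t).
move: E; rewrite P2; move: (cos _) (_^-1) i4 i0 => C I i4 i0 E C1.
(* Replacing the mass [s] by 1 costs one further [delta]. *)
have D : `|(2 * (s ^+ 2 * I) - 2 * I) * (1 - C)| <= delta.
  apply: (le_trans _ dd); rewrite normrM (_ : delta ^+ 2 = delta ^+ 2 / 2 * 2); last by field.
  apply: ler_pM => //; last first.
    by apply: le_trans (ler_normB _ _) _; rewrite normr1; lra.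
  have s2 : 0 <= 1 - s ^+ 2 <= delta ^+ 2.
    have := mulr_ge0 s0 (_ : 0 <= 1 - s); rewrite subr_ge0 => /(_ s1) ss.
    by have := sqr_ge0 (1 - s); move=> ?; apply/andP; split; lra.
  rewrite (_ : _ - _ = - (2 * I * (1 - s ^+ 2))); last by ring.
  case/andP: s2 => s20 s2d.
  rewrite normrN ger0_norm ?mulr_ge0// mulrC ler_pM// ?mulr_ge0//; lra.
rewrite (_ : _ - _ = (amp2 H x y t - 2 * (s ^+ 2 * I) * (1 - C)) +
  (2 * (s ^+ 2 * I) - 2 * I) * (1 - C)); last by ring.
by apply: le_trans (ler_normD _ _) _; lra.
Qed.

End TwoModes.

Lemma mpowS (R : realType) (T : finType) (A : T -> T -> R) k v w :
  mpow A k.+1 v w = \sum_z A v z * mpow A k z w.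
Proof. by []. Qed.

(** * The normalized adjacency matrix, walks and return probabilities *)

Section NormalizedAdjacency.
Variables (R : realType) (T : finType) (e : rel T).
Hypothesis eg : simple_graph e.
Implicit Types (v w : T) (f : T -> R).

Let dR v : R := (deg e v)%:R.

Definition nadj v w : R :=
  if e v w then (Num.sqrt ((deg e v)%:R * (deg e w)%:R))^-1 else 0.

Lemma nadj_sym v w : nadj v w = nadj w v.
Proof. by rewrite /nadj eg.1 [X in Num.sqrt X]mulrC. Qed.

Lemma deg_gt0 v w : e v w -> (0 < deg e v)%N.
Proof. by move=> vw; apply/card_gt0P; exists w; rewrite in_setE. Qed.

Lemma nadj_ge0 v w : 0 <= nadj v w.
Proof. by rewrite /nadj; case: ifP => // _; rewrite invr_ge0 sqrtr_ge0. Qed.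

Lemma nadj_gt0 v w : e v w -> 0 < nadj v w.
Proof.
move=> vw; rewrite /nadj vw invr_gt0 sqrtr_gt0 mulr_gt0// ltr0n.
  exact: deg_gt0 vw.
by apply: (@deg_gt0 _ v); rewrite eg.1.
Qed.

Lemma laplacian_nadj v w : laplacian R e v w = (v == w)%:R - nadj v w.
Proof.
rewrite /laplacian /nadj; case: eqP => [->|_]; first by rewrite eg.2 subr0.
by case: ifP => _; rewrite sub0r ?oppr0.
Qed.

Lemma hamiltonian_sym (W : T -> R) Q v w :
  hamiltonian e W Q v w = hamiltonian e W Q w v.
Proof.
rewrite /hamiltonian !laplacian_nadj nadj_sym (eq_sym w v).
by case: eqP => [->|].
Qed.

Lemma app_hamiltonian (W : T -> R) Q f v :
  app (hamiltonian e W Q) f v = f v - app nadj f v - Q * (W v * f v).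
Proof.
rewrite /app /hamiltonian.
rewrite (eq_bigr (fun w => ((v == w)%:R * f w - nadj v w * f w) -
   Q * ((v == w)%:R * (W v * f w)))) => [|w _]; last first.
  by rewrite laplacian_nadj; case: eqP => _ /=; ring.
rewrite !sumrB -mulr_sumr; congr (_ - _ - Q * _).
  by rewrite -[RHS](dot_chil v f) /dot; apply: eq_bigr => w _; rewrite /chi eq_sym.
rewrite -[RHS](dot_chil v (fun w => W v * f w)) /dot.
by apply: eq_bigr => w _; rewrite /chi eq_sym.
Qed.

(* The walk matrix is conjugate to the normalized adjacency matrix by the
   diagonal matrix of the square roots of the degrees. *)
Lemma mpow_rw_nadj k v w : mpow (rw_matrix R e) k v w * Num.sqrt (dR v) =
  mpow nadj k v w * Num.sqrt (dR w).
Proof.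
elim: k v => [|k IH] v; first by rewrite /mpow /= /mid; case: eqP => [->|_]; rewrite ?mul0r.
rewrite !mpowS !mulr_suml; apply: eq_bigr => z _.
rewrite -[RHS]mulrA -IH mulrAC.
suff -> : rw_matrix R e v z * Num.sqrt (dR v) = nadj v z * Num.sqrt (dR z) by ring.
rewrite /rw_matrix /nadj; case: ifP => [vz|_]; last by rewrite !mul0r.
have dv : 0 < dR v by rewrite ltr0n (deg_gt0 vz).
have dz : 0 < dR z by rewrite ltr0n; apply: (@deg_gt0 _ v); rewrite eg.1.
rewrite -/(dR v) -/(dR z) sqrtrM ?(ltW dv)// -{1}(sqr_sqrtr (ltW dv)).
have sv : 0 < Num.sqrt (dR v) by rewrite sqrtr_gt0.
have sz : 0 < Num.sqrt (dR z) by rewrite sqrtr_gt0.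
by field; rewrite !gt_eqF.
Qed.

(** Conjugation by a diagonal matrix preserves diagonal entries; positive degree makes the
    conjugating factor cancellable. *)
Lemma PR_nadj k v : (0 < deg e v)%N -> PR R e v k = mpow nadj k v v.
Proof.
move=> dv; apply: (@mulIf _ (Num.sqrt (dR v))); last exact: mpow_rw_nadj.
by rewrite gt_eqF// sqrtr_gt0 ltr0n.
Qed.

Lemma mpow_nadj_ge0 k v w : 0 <= mpow nadj k v w.
Proof.
elim: k v => [|k IH] v; first by rewrite /mpow /= /mid.
by apply: sumr_ge0 => z _; rewrite mulr_ge0 ?nadj_ge0//; exact: IH.
Qed.

Lemma mpow_nadj_gt0 k v w : walk_of_length e v w k -> 0 < mpow nadj k v w.
Proof.
elim: k v => [|k IH] v [p [sp pp lp]].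
  by case: p sp pp lp => //= _ _ ->; rewrite /mpow /= /mid eqxx.
case: p sp pp lp => //= z p [sp] /andP[vz pp] lp.
have zw : 0 < mpow nadj k z w by apply: IH; exists p.
rewrite /mmul (bigD1 z)//= ltr_pwDl ?mulr_gt0 ?nadj_gt0//.
by apply: sumr_ge0 => u _; rewrite mulr_ge0 ?nadj_ge0//; exact: mpow_nadj_ge0.
Qed.

Lemma mpow_nadj_eq0 k v w : ~ walk_of_length e v w k -> mpow nadj k v w = 0.
Proof.
elim: k v => [|k IH] v nw.
  rewrite /mpow /= /mid; case: eqP => // vw; exfalso; apply: nw.
  by exists [::]; split.
rewrite mpowS big1// => z _.
rewrite /nadj; case: ifP => [vz|_]; last by rewrite mul0r.
suff -> : mpow nadj k z w = 0 by rewrite mulr0.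
apply: IH => -[p [sp pp lp]]; apply: nw; exists (z :: p).
by rewrite /= sp vz pp.
Qed.

End NormalizedAdjacency.

(** * Resolvent of a symmetric matrix at large spectral parameter *)

Section Resolvent.
Variables (R : realType) (T : finType) (N : T -> T -> R).
Hypothesis Nsym : forall v w, N v w = N w v.
Implicit Types (p q v w : T) (s f : T -> R) (l : R).

(** A single constant above 1, the entry sum of the matrix and [#|T|], in which all error bounds are
    expressed. *)
Definition opsize : R := (1 + entry_sum N) * (1 + #|T|%:R).
Notation K := opsize.

Lemma opsize_ge1 : 1 <= K.
Proof.
by have := entry_sum_ge0 N; have := ler0n R #|T| => t0 e0; rewrite /K; nra.
Qed.

Lemma entry_sum_le_opsize : entry_sum N + 1 <= K.
Proof. by have := entry_sum_ge0 N; have := ler0n R #|T| => t0 e0; rewrite /K; nra. Qed.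

Lemma card_le_opsize : #|T|%:R <= K.
Proof. by have := entry_sum_ge0 N; have := ler0n R #|T| => t0 e0; rewrite /K; nra. Qed.

(** Above this value the relative error [2 * K / l] in [resolvent_entry] is at most [(8 * K)^-1], so
    products of two such errors still sum to at most [1 / 64] over [T]. *)
Definition cutoff : R := 16 * K ^+ 2.

Lemma cutoff_ge l : cutoff <= l -> 16 <= l /\ 16 * K <= l.
Proof. by rewrite /cutoff => H; have := opsize_ge1; split; nra. Qed.

(** [s] is column [q] of [(l - N)^-1], given by its equation instead of a matrix inverse. *)
Definition resolves l q s := forall v, l * s v = chi R q v + app N s v.

Lemma resolvent_exists l q : cutoff <= l -> exists s, resolves l q s.
Proof.
move=> /cutoff_ge[l16 lK].
pose A v w := l * (v == w)%:R - N v w.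
have appA f v : app A f v = l * f v - app N f v.
  rewrite /app /A -[in l * f v](dot_chil v f) /dot mulr_sumr -sumrB.
  by apply: eq_bigr => w _; rewrite /chi eq_sym; ring.
have inj f : (forall v, app A f v = 0) -> forall v, f v = 0.
  move=> Af0 v; apply/eqP; rewrite -normr_le0; apply: le_trans (norm_le_l1 f v) _.
  have : l * l1 f <= entry_sum N * l1 f.
    apply: le_trans (l1_app N f); rewrite /l1 mulr_sumr; apply: ler_sum => w _.
    have /eqP := Af0 w; rewrite appA subr_eq0 => /eqP <-.
    by rewrite normrM ger0_norm; lra.
  have := l1_ge0 f; have := entry_sum_le_opsize; nra.
have [s As] := app_onto inj (chi R q); exists s => v.
by have := As v; rewrite appA => <-; ring.
Qed.

Lemma l1_resolvent l q s : cutoff <= l -> resolves l q s -> l1 s <= 2 / l.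
Proof.
move=> /cutoff_ge[l16 lK] rs.
have : l * l1 s <= 1 + entry_sum N * l1 s.
  apply: (le_trans (y := l1 (chi R q) + l1 (app N s))).
    rewrite /l1 mulr_sumr -big_split /=; apply: ler_sum => w _.
    by rewrite -[l]ger0_norm ?normrM -?normrM ?(ger0_norm (_ : 0 <= l)) ?rs ?ler_normD//; lra.
  by rewrite l1_chi lerD2l; exact: l1_app.
move=> H; rewrite ler_pdivlMr; last by lra.
have := l1_ge0 s; have := entry_sum_le_opsize; nra.
Qed.

Lemma norm_app_resolvent l q s v : cutoff <= l -> resolves l q s ->
  `|app N s v| <= 2 * K / l.
Proof.
move=> lc rs; apply: le_trans (norm_le_l1 _ _) _; apply: le_trans (l1_app _ _) _.
rewrite mulrAC mulrC; apply: ler_pM; rewrite ?l1_ge0 ?entry_sum_ge0//.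
  exact: l1_resolvent rs.
by have := entry_sum_le_opsize; lra.
Qed.

Lemma resolvent_entry l q s v : cutoff <= l -> resolves l q s ->
  `|s v - chi R q v / l| <= 2 * K / l ^+ 2.
Proof.
move=> lc rs; have [l16 _] := cutoff_ge lc; have l0 : 0 < l by lra.
have -> : s v - chi R q v / l = app N s v / l.
  have := rs v; move: (chi R q v) (app N s v) => a b E.
  have -> : s v = (a + b) / l by rewrite -E mulrC mulKf// gt_eqF.
  by field; rewrite gt_eqF.
rewrite normrM normfV (ger0_norm (ltW l0)) expr2 invfM mulrA ler_wpM2r//.
  by rewrite invr_ge0 ltW.
exact: norm_app_resolvent rs.
Qed.

(** The first resolvent identity, entrywise. At [l = l'] it yields symmetry of the resolvent, for
    varying [l] its Lipschitz continuity, and at the two eigenvalues the equation for the gap. *)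
Lemma resolvent_cross l l' p q s s' : resolves l p s -> resolves l' q s' ->
  s q - s' p = (l' - l) * dot s s'.
Proof.
move=> rs rs'.
have E : dot s (app N s') = dot s' (app N s).
  by rewrite dot_app_sym// dotC.
have A : s q = l' * dot s s' - dot s (app N s').
  rewrite -(dot_chil q s) dotC -dotZr.
  suff -> : (fun v => l' * s' v) = (fun v => chi R q v + app N s' v).
    by rewrite dotDr addrK.
  exact/funext.
have B : s' p = l * dot s s' - dot s' (app N s).
  rewrite -(dot_chil p s') dotC (dotC s) -dotZr.
  suff -> : (fun v => l * s v) = (fun v => chi R p v + app N s v).
    by rewrite dotDr addrK.
  exact/funext.
by rewrite A B E; ring.
Qed.

Lemma resolvent_iter l q s k v : resolves l q s ->
  l * iter k (app N) s v = iter k (app N) (chi R q) v + iter k.+1 (app N) s v.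
Proof.
move=> rs; elim: k v => [|k IH] v; first exact: rs.
rewrite iterS -appZ [in RHS]iterS [in X in _ + X]iterS -appD.
congr (app N _ v); exact/funext.
Qed.

Lemma resolvent_expansion l q s m v : cutoff <= l -> resolves l q s ->
  `|s v - \sum_(0 <= k < m) mpow N k v q / l ^+ k.+1| <= 2 * K ^+ m / l ^+ m.+1.
Proof.
move=> lc rs; have [l16 _] := cutoff_ge lc; have l0 : 0 < l by lra.
(* The Neumann series stopped before order [m] has the exact remainder [N^m s / l^m]. *)
have -> : s v - \sum_(0 <= k < m) mpow N k v q / l ^+ k.+1 =
    iter m (app N) s v / l ^+ m.
  elim: m => [|m IH]; first by rewrite big_geq// expr0 divr1 subr0.
  rewrite big_nat_recr//= opprD addrA IH -iterS mpow_iter.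
  have -> : iter m.+1 (app N) s v =
      l * iter m (app N) s v - iter m (app N) (chi R q) v.
    by rewrite (resolvent_iter m v rs) addrAC subrr add0r.
  by rewrite exprS; field; rewrite expf_neq0 gt_eqF.
rewrite normrM normfV normrX (ger0_norm (ltW l0)) exprSr invfM mulrA mulrAC ler_pM//.
- by rewrite invr_ge0 exprn_ge0// ltW.
- rewrite mulrAC.
  apply: le_trans (norm_le_l1 _ _) _; apply: le_trans (l1_iter_app _ _ _) _.
  apply: ler_pM; rewrite ?l1_ge0 ?exprn_ge0 ?entry_sum_ge0//.
    exact: l1_resolvent rs.
  apply: lerXn2r; rewrite ?nnegrE ?entry_sum_ge0//; first by have := opsize_ge1; lra.
  by have := entry_sum_le_opsize; lra.
Qed.

(** Both [l * s] and [l' * s'] are entrywise close to [chi q]: entry [q] contributes at least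
    [(7/8)^2] to the scaled product, all others together at most [1/64] in absolute value. The upper
    bound is the product of the l1 bounds. *)
Lemma resolvent_dot_bounds l l' q s s' : cutoff <= l -> cutoff <= l' ->
  resolves l q s -> resolves l' q s' ->
  1 / 2 / (l * l') <= dot s s' <= 4 / (l * l').
Proof.
move=> lc lc' rs rs'.
have [l16 lK] := cutoff_ge lc; have l0 : 0 < l by lra.
have [l16' lK'] := cutoff_ge lc'; have l0' : 0 < l' by lra.
have K1 := opsize_ge1; have TK := card_le_opsize.
apply/andP; split; last first.
  apply: le_trans (ler_norm _) _; apply: le_trans (norm_dot_le _ _) _.
  rewrite (_ : 4 / _ = 2 / l * (2 / l')); last by field; rewrite !gt_eqF.
  by apply: ler_pM; rewrite ?l1_ge0//; [exact: l1_resolvent rs|exact: l1_resolvent rs'].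
rewrite ler_pdivrMr ?mulr_gt0//.
have small z : cutoff <= z -> 0 <= 2 * K / z <= (8 * K)^-1.
  move=> zc; have [z16 zK] := cutoff_ge zc; have z0 : 0 < z by lra.
  rewrite divr_ge0/=; [|lra|lra].
  rewrite ler_pdivrMr// ler_pdivlMl; last by lra.
  by move: zc; rewrite /cutoff; lra.
have entry z t v : cutoff <= z -> resolves z q t ->
    `|z * t v - chi R q v| <= 2 * K / z.
  move=> zc rt; have [z16 _] := cutoff_ge zc; have z0 : 0 < z by lra.
  have -> : z * t v - chi R q v = z * (t v - chi R q v / z).
    by field; rewrite gt_eqF.
  rewrite normrM (ger0_norm (ltW z0)).
  have := resolvent_entry v zc rt; rewrite expr2 invfM mulrA -ler_pdivlMl//.
  by rewrite (mulrC z^-1).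
have /andP[u0 u8] := small _ lc; have /andP[u0' u8'] := small _ lc'.
have uu : 2 * K / l * (2 * K / l') <= (64 * K)^-1.
  apply: (le_trans (ler_pM u0 u0' u8 u8')).
  rewrite -invfM lef_pV2 ?posrE; nra.
have K8 : (8 * K)^-1 <= 8^-1 by rewrite lef_pV2 ?posrE; lra.
have -> : dot s s' * (l * l') =
    \sum_v (l * s v) * (l' * s' v).
  by rewrite /dot mulr_suml; apply: eq_bigr => v _; ring.
rewrite (bigD1 q)//=.
have E1 := entry _ _ q lc rs; have E1' := entry _ _ q lc' rs'.
have main : 49 / 64 <= l * s q * (l' * s' q).
  have chiq : chi R q q = 1 by rewrite /chi eqxx.
  move: E1 E1'; rewrite chiq !ler_norml => /andP[a1 a2] /andP[b1 b2].
  rewrite (_ : 49 / 64 = 7 / 8 * (7 / 8)); last by field.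
  by apply: ler_pM; lra.
have rest : `|\sum_(v | v != q) l * s v * (l' * s' v)| <= 1 / 64.
  apply: le_trans (ler_norm_sum _ _ _) _.
  apply: (le_trans (y := \sum_(v : T | v != q) (64 * K)^-1)).
    apply: ler_sum => v vq; rewrite normrM.
    have := entry _ _ v lc rs; have := entry _ _ v lc' rs'.
    have -> : chi R q v = 0 by rewrite /chi (negbTE vq).
    rewrite !subr0 => e' e.
    by apply: le_trans uu; apply: ler_pM.
  apply: (le_trans (y := \sum_(v : T) (64 * K)^-1)).
    by rewrite [leRHS](bigD1 q)//= lerDr invr_ge0; lra.
  rewrite sumr_const -[leLHS]mulr_natl ler_pdivrMr; last by lra.
  have -> : #|xpredT : pred T| = #|T| by exact: eq_card.
  by lra.
by move: rest; rewrite ler_norml => /andP[? ?]; lra.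
Qed.

End Resolvent.

(** * Locating two roots by the intermediate value theorem *)

Section Crossings.
Variable R : realType.
Implicit Types (f g h : R -> R) (a b : R).

Lemma short_map_continuous f :
  (forall a b, `|f a - f b| <= `|a - b|) -> continuous f.
Proof.
move=> fl z; apply/cvgrPdist_lt => eps eps0; near=> u.
apply: le_lt_trans (fl z u) _.
by near: u; apply: cvgr_dist_lt => //; exact: cvg_id.
Unshelve. all: by end_near. Qed.

Lemma ivt_zero f a b : a <= b -> continuous f ->
  Num.min (f a) (f b) <= 0 <= Num.max (f a) (f b) ->
  exists c, [/\ a <= c, c <= b & f c = 0].
Proof.
move=> ab cf f0; have [|c] := IVT ab _ f0; first exact: continuous_subspaceT.
by rewrite in_itv/= => /andP[ac cb] fc; exists c.
Qed.

(* [g^2 - h h'] is negative at both ends, and positive at the zero of [h]. *)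
Lemma two_crossings g h h' a b :
  continuous g -> continuous h -> continuous h' -> a <= b ->
  h a < 0 -> 0 < h b ->
  g a ^+ 2 < h a * h' a -> g b ^+ 2 < h b * h' b ->
  (forall l, a <= l <= b -> g l != 0) ->
  exists l l0 l', [/\ a <= l', l' < l0, l0 < l & l <= b] /\
    [/\ h l0 = 0, h l * h' l = g l ^+ 2 & h l' * h' l' = g l' ^+ 2].
Proof.
move=> cg ch ch' ab ha hb Da Db g0.
have [|l0 [al0 l0b hl0]] := ivt_zero ab ch.
  by rewrite (min_idPl _) ?(max_idPr _) ?(ltW ha) ?(ltW hb)//; apply: ltW; exact: lt_trans hb.
pose D l := h l * h' l - g l * g l.
have cD : continuous D.
  by move=> z; apply: cvgB; apply: cvgM; [exact: ch|exact: ch'|exact: cg|exact: cg].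
have D0 : D l0 < 0.
  rewrite /D hl0 mul0r sub0r oppr_lt0 -expr2 lt_neqAle sqr_ge0 andbT.
  by rewrite eq_sym expf_neq0// g0// al0 l0b.
have Da0 : 0 < D a by rewrite /D subr_gt0 -expr2.
have Db0 : 0 < D b by rewrite /D subr_gt0 -expr2.
have [|l [l0l lb Dl]] := ivt_zero l0b cD.
  by rewrite (min_idPl _) ?(max_idPr _) ?(ltW D0) ?(ltW Db0)//; apply: ltW; exact: lt_trans Db0.
have [|l' [al' l'l0 Dl']] := ivt_zero al0 cD.
  by rewrite (min_idPr _) ?(max_idPl _) ?(ltW D0) ?(ltW Da0)//; apply: ltW; exact: lt_trans Da0.
exists l, l0, l'; split; split => //.
- by rewrite lt_neqAle l'l0 andbT; apply/eqP => E; move: D0; rewrite -E Dl' ltxx.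
- by rewrite lt_neqAle l0l andbT; apply/eqP => E; move: D0; rewrite E Dl ltxx.
- by apply/eqP; rewrite -subr_eq0 expr2 -/(D l) Dl.
- by apply/eqP; rewrite -subr_eq0 expr2 -/(D l') Dl'.
Qed.

End Crossings.

(** * The two eigenvalues near [Q] and their eigenvectors *)

Section WellModes.
Variables (R : realType) (T : finType) (e : rel T) (x y : T).
Hypotheses (eg : simple_graph e) (xy : x != y).
Notation N := (nadj R e).
Notation K := (opsize N).
Notation L := (cutoff N).
Variable s : R -> T -> T -> R.
(* Clamping the spectral parameter makes the resolvent entries globally 1-Lipschitz. *)
Hypothesis sP : forall l q, resolves N (Num.max l L) q (s l q).

Let Nsym := @nadj_sym R T e eg.
Definition res p q l : R := s l q p.

Lemma resolves_family l q : L <= l -> resolves N l q (s l q).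
Proof. by move=> Ll; have := sP l q; rewrite max_l. Qed.

Lemma res_sym p q l : res p q l = res q p l.
Proof.
have := resolvent_cross Nsym (sP l q) (sP l p).
by rewrite subrr mul0r => /eqP; rewrite subr_eq0 => /eqP.
Qed.

Lemma res_lipschitz p q a b : `|res p q a - res p q b| <= `|a - b|.
Proof.
rewrite [res p q b]res_sym /res (resolvent_cross Nsym (sP a q) (sP b p)).
have M c : L <= Num.max c L by rewrite le_max lexx orbT.
have l1s c r : l1 (s c r) <= 1.
  apply: le_trans (l1_resolvent (M c) (sP c r)) _.
  by have [? _] := cutoff_ge (M c); rewrite ler_pdivrMr; lra.
rewrite normrM -[leRHS]mulr1; apply: ler_pM => //.
  rewrite distrC /Num.max; case: ltP => aL; case: ltP => bL.
  - by rewrite subrr normr0.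
  - by rewrite !ler0_norm; lra.
  - by rewrite !ger0_norm; lra.
  - by [].
apply: le_trans (norm_dot_le _ _) _; rewrite -[leRHS]mulr1.
by apply: ler_pM; rewrite ?l1_ge0.
Qed.

Lemma res_continuous p q : continuous (res p q).
Proof. by apply: short_map_continuous; exact: res_lipschitz. Qed.

Definition well_defect Q p l : R := Q^-1 - res p p l.

Lemma well_defect_continuous Q p : continuous (well_defect Q p).
Proof. by move=> z; apply: cvgB; [exact: cvg_cst|exact: res_continuous]. Qed.

Lemma well_defect_diff Q l l' : L <= l -> L <= l' ->
  well_defect Q x l - well_defect Q x l' = (l - l') * dot (s l x) (s l' x).
Proof.
move=> Ll Ll'; have := resolvent_cross Nsym (resolves_family x Ll) (resolves_family x Ll').
by rewrite /well_defect /res => E; rewrite -[l - l']opprB mulNr -E; ring.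
Qed.

(** The shift [8 * K] makes [1/l - 1/Q] exceed twice the resolvent error [2 * K / l^2]: one copy
    absorbs the error of the diagonal entry, the other dominates the coupling [res x y], as the
    endpoint condition of [two_crossings] requires. *)
Lemma well_defect_below Q p : 2 * L <= Q ->
  well_defect Q p (Q - 8 * K) < - (2 * K / (Q - 8 * K) ^+ 2).
Proof.
move=> LQ; have K1 := opsize_ge1 N.
have Lc : L <= Q - 8 * K by have := cutoff_ge (lexx L); move=> [? ?]; lra.
have [l16 lK] := cutoff_ge Lc.
have := resolvent_entry p Lc (resolves_family p Lc).
have -> : chi R p p = 1 by rewrite /chi eqxx.
rewrite ler_norml /well_defect /res => /andP[E _].
suff : Q^-1 - 1 / (Q - 8 * K) < - (4 * K / (Q - 8 * K) ^+ 2) by lra.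
set l := Q - 8 * K in l16 lK *; have -> : Q = l + 8 * K by rewrite /l; ring.
rewrite -subr_lt0 (_ : _ - _ = (4 * K * (8 * K - l)) / ((l + 8 * K) * l ^+ 2)).
  rewrite pmulr_llt0; first by nra.
  by rewrite invr_gt0 mulr_gt0 ?exprn_gt0//; lra.
by field; rewrite !gt_eqF//; lra.
Qed.

Lemma well_defect_above Q p : 2 * L <= Q ->
  2 * K / (Q + 8 * K) ^+ 2 < well_defect Q p (Q + 8 * K).
Proof.
move=> LQ; have K1 := opsize_ge1 N.
have Lc : L <= Q + 8 * K by have := cutoff_ge (lexx L); move=> [? ?]; lra.
have [l16 lK] := cutoff_ge Lc; have [L16 LK] := cutoff_ge (lexx L).
have := resolvent_entry p Lc (resolves_family p Lc).
have -> : chi R p p = 1 by rewrite /chi eqxx.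
rewrite ler_norml /well_defect /res => /andP[_ E].
suff : 4 * K / (Q + 8 * K) ^+ 2 < Q^-1 - 1 / (Q + 8 * K) by lra.
rewrite -subr_gt0 (_ : _ - _ = (4 * K * (Q + 16 * K)) / (Q * (Q + 8 * K) ^+ 2)).
  apply: divr_gt0; apply: mulr_gt0; try lra.
  by apply: exprn_gt0; lra.
by field; rewrite !gt_eqF//; lra.
Qed.

(** The zero of [well_defect Q x] separates the two roots, and this function is strictly increasing
    by [well_defect_diff]. The resulting signs say that one mode is symmetric-like and the other
    antisymmetric-like. *)
Lemma well_eigenvalues Q : 2 * L <= Q ->
  (forall l, Q / 2 <= l <= 2 * Q -> 0 < res x y l) ->
  exists l l', [/\ Q / 2 <= l', l' < l & l <= 2 * Q] /\
  [/\ well_defect Q x l * well_defect Q y l = res x y l ^+ 2,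
      well_defect Q x l' * well_defect Q y l' = res x y l' ^+ 2,
      0 < well_defect Q x l & well_defect Q x l' < 0].
Proof.
move=> LQ g0; have K1 := opsize_ge1 N; have [L16 LK] := cutoff_ge (lexx L).
pose a := Q - 8 * K; pose b := Q + 8 * K.
have La : L <= a by rewrite /a; lra.
have Lb : L <= b by rewrite /b; lra.
have rxy z : L <= z -> `|res x y z| <= 2 * K / z ^+ 2.
  move=> Lz; have := resolvent_entry x Lz (resolves_family y Lz).
  have -> : chi R y x = 0 by rewrite /chi (negbTE xy).
  by rewrite mul0r subr0.
have sq (u v w c : R) : `|w| <= c -> c < u -> c < v -> w ^+ 2 < u * v.
  move=> wc cu cv; have w0 := normr_ge0 w.
  rewrite -real_normK ?num_real// expr2; apply: ltr_pM => //; lra.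
have ax := well_defect_below x LQ; have ay := well_defect_below y LQ.
have bx := well_defect_above x LQ; have bY := well_defect_above y LQ.
have ca : 0 <= 2 * K / a ^+ 2 by rewrite divr_ge0 ?sqr_ge0//; lra.
have cb : 0 <= 2 * K / b ^+ 2 by rewrite divr_ge0 ?sqr_ge0//; lra.
have [||||||l [l0 [l' [[al' l'l0 l0l lb] [h0 D D']]]]] :=
  @two_crossings R (res x y) (well_defect Q x) (well_defect Q y) a b
    (@res_continuous x y) (@well_defect_continuous Q x) (@well_defect_continuous Q y).
- by rewrite /a /b; lra.
- by apply: lt_le_trans ax _; rewrite oppr_le0.
- exact: le_lt_trans bx.
- by rewrite -mulrNN; apply: sq (rxy _ La) _ _; rewrite ltrNr.
- exact: sq (rxy _ Lb) bx bY.
- move=> z /andP[az zb]; rewrite gt_eqF// g0//; move: az zb; rewrite /a /b.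
  by move=> ? ?; apply/andP; split; lra.
have pos z z' : L <= z -> L <= z' -> z' < z -> well_defect Q x z' < well_defect Q x z.
  move=> Lz Lz' zz'; rewrite -subr_gt0 well_defect_diff// mulr_gt0 ?subr_gt0//.
  have /andP[+ _] := resolvent_dot_bounds Lz Lz' (resolves_family x Lz) (resolves_family x Lz').
  apply: lt_le_trans; have [? _] := cutoff_ge Lz; have [? _] := cutoff_ge Lz'.
  by rewrite !divr_gt0// mulr_gt0//; lra.
exists l, l'; move: al' lb; rewrite /a /b => al' lb.
split; split => //; try lra.
- by rewrite -h0; apply: pos => //; lra.
- by rewrite -h0; apply: pos => //; lra.
Qed.

(** The eigenvector scaled to take the value [1/Q] at [x]; the coefficient of the second column is
    the ratio of its values at [y] and [x]. *)
Definition mode Q l v : R := s l x v + well_defect Q x l / res x y l * s l y v.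

Lemma mode_x Q l : res x y l != 0 -> mode Q l x = Q^-1.
Proof.
move=> g0; rewrite /mode -[s l x x]/(res x x l) -[s l y x]/(res x y l).
by rewrite divfK// /well_defect; ring.
Qed.

Lemma mode_y Q l : res x y l != 0 ->
  well_defect Q x l * well_defect Q y l = res x y l ^+ 2 ->
  mode Q l y = well_defect Q x l / res x y l * mode Q l x.
Proof.
move=> g0 D; rewrite mode_x// /mode -[s l x y]/(res y x l) -[s l y y]/(res y y l) res_sym.
have -> : res y y l = Q^-1 - well_defect Q y l by rewrite /well_defect; ring.
rewrite mulrBr (_ : _ / _ * well_defect Q y l = res x y l); first by ring.
by rewrite mulrAC D; field.
Qed.

Lemma mode_eigen Q l v : L <= l -> Q != 0 -> res x y l != 0 ->
  well_defect Q x l * well_defect Q y l = res x y l ^+ 2 ->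
  app (hamiltonian e (double_well R x y) Q) (mode Q l) v = (1 - l) * mode Q l v.
Proof.
move=> Ll Q0 g0 D; rewrite app_hamiltonian//.
have -> : app N (mode Q l) v = l * mode Q l v -
    (chi R x v + well_defect Q x l / res x y l * chi R y v).
  rewrite /mode appD appZ mulrDr mulrCA (resolves_family x Ll) (resolves_family y Ll).
  by ring.
have -> : Q * (double_well R x y v * mode Q l v) =
    chi R x v + well_defect Q x l / res x y l * chi R y v.
  rewrite /double_well /chi; have [->|vx] := eqVneq v x.
    by rewrite (negbTE xy) /= mulr0 addr0 mul1r mode_x// divff.
  have [->|vy] := eqVneq v y; last by rewrite /= mulr0 mul0r mulr0 addr0.
  by rewrite /= mul1r add0r mulr1 mode_y// mode_x// mulrCA divff// mulr1.
by ring.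
Qed.

(* Off the wells the eigenvalue equation reads [l p = N p]. *)
Lemma mode_concentrated Q l (p : T -> R) : L <= l -> dot p p = 1 ->
  (forall v, app (hamiltonian e (double_well R x y) Q) p v = (1 - l) * p v) ->
  1 - K ^+ 3 / l ^+ 2 <= p x ^+ 2 + p y ^+ 2.
Proof.
move=> Ll p1 Hp; have [l16 lK] := cutoff_ge Ll; have l0 : 0 < l by lra.
have K1 := opsize_ge1 N.
have off v : v != x -> v != y -> p v ^+ 2 <= K ^+ 2 / l ^+ 2.
  move=> vx vy; have := Hp v; rewrite app_hamiltonian// /double_well (negbTE vx) (negbTE vy).
  rewrite /= mul0r mulr0 subr0 => E.
  have {}E : p v = app N p v / l.
    by apply: (@mulIf _ l); rewrite ?gt_eqF// divfK ?gt_eqF//; lra.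
  rewrite E expr_div_n ler_wpM2r ?invr_ge0 ?sqr_ge0// -[X in X <= _]real_normK ?num_real//.
  apply: lerXn2r; rewrite ?nnegrE//; first lra.
  apply: (le_trans (y := entry_sum N)); last by have := entry_sum_le_opsize N; lra.
  apply: le_trans (ler_norm_sum _ _ _) _.
  rewrite /entry_sum [leRHS](bigD1 v)//=; apply: ler_wpDr.
    by apply: sumr_ge0 => w _; exact: sumr_ge0.
  apply: ler_sum => w _; rewrite normrM -[leRHS]mulr1 ler_wpM2l//.
  rewrite -(@ler_pXn2r _ 2) ?nnegrE// real_normK ?num_real// expr1n -p1.
  exact: sqr_le_dot.
have := p1; rewrite /dot (bigD1 x)//= (bigD1 y) ?(eq_sym y)//= -!expr2 addrA => <-.
rewrite lerBlDr lerD2l.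
apply: (le_trans (y := \sum_(v : T) K ^+ 2 / l ^+ 2)).
  rewrite [leRHS](bigID (fun v => (v != x) && (v != y)))/=; apply: ler_wpDr.
    by apply: sumr_ge0 => v _; rewrite divr_ge0 ?sqr_ge0.
  by apply: ler_sum => v /andP[vx vy]; rewrite -expr2; exact: off.
rewrite sumr_const -[leLHS]mulr_natl (_ : K ^+ 3 / l ^+ 2 = K * (K ^+ 2 / l ^+ 2));
  last by rewrite exprS mulrA.
have -> : #|xpredT : pred T| = #|T| by exact: eq_card.
by rewrite ler_wpM2r ?card_le_opsize// divr_ge0 ?sqr_ge0.
Qed.

Definition kappa l : R := (res y y l - res x x l) / res x y l.

(** The determinant equation identifies [1/r] with [well_defect Q y l / res x y l], and in [r - 1/r]
    the two terms [1/Q] cancel. Multiplying by [r] keeps the relation polynomial. *)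
Lemma ratio_kappa Q l : res x y l != 0 ->
  well_defect Q x l * well_defect Q y l = res x y l ^+ 2 ->
  (well_defect Q x l / res x y l) ^+ 2 - 1 = kappa l * (well_defect Q x l / res x y l).
Proof.
move=> g0 D; rewrite /kappa.
have -> : res y y l - res x x l = well_defect Q x l - well_defect Q y l.
  by rewrite /well_defect; ring.
transitivity ((well_defect Q x l ^+ 2 - well_defect Q x l * well_defect Q y l) / res x y l ^+ 2).
  by rewrite D; field.
by field.
Qed.

Lemma normalized_mode Q l : 0 < Q -> res x y l != 0 ->
  exists c, dot (fun v => c * mode Q l v) (fun v => c * mode Q l v) = 1.
Proof.
move=> Q0 g0; have d0 : 0 < dot (mode Q l) (mode Q l).
  apply: lt_le_trans (sqr_le_dot (mode Q l) x).
  by rewrite mode_x// exprn_gt0// invr_gt0.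
exists (Num.sqrt (dot (mode Q l) (mode Q l)))^-1.
rewrite dotZl dotZr mulrA -invfM -expr2 sqr_sqrtr ?(ltW d0)//.
by rewrite mulVf// gt_eqF.
Qed.

Lemma wells_estimate Q delta : 2 * L <= Q -> 0 < delta <= 1 ->
  8 * K ^+ 3 <= delta ^+ 2 * Q ^+ 2 ->
  (forall l, Q / 2 <= l <= 2 * Q -> 0 < res x y l) ->
  exists l l', [/\ Q / 2 <= l', l' < l & l <= 2 * Q] /\
  [/\ well_defect Q x l * well_defect Q y l = res x y l ^+ 2,
      well_defect Q x l' * well_defect Q y l' = res x y l' ^+ 2,
      0 < well_defect Q x l & well_defect Q x l' < 0] /\
  forall t, `|amp2 (hamiltonian e (double_well R x y) Q) x y t -
     2 / (kappa l ^+ 2 + 4) * (1 - cos ((l - l') * t))| <= 8 * delta.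
Proof.
move=> LQ d01 Qd g0.
have [L16 LK] := cutoff_ge (lexx L); have Q0 : 0 < Q by lra.
have [l [l' [ll [D D' h h']]]] := well_eigenvalues LQ g0.
exists l, l'; split => //; split => // t.
have [Ql' l'l lQ] := ll.
have Ll : L <= l by lra.
have Ll' : L <= l' by lra.
have gl : res x y l != 0 by rewrite gt_eqF// g0//; apply/andP; split; lra.
have gl' : res x y l' != 0 by rewrite gt_eqF// g0//; apply/andP; split; lra.
have Qn : Q != 0 by rewrite gt_eqF.
have [c c1] := normalized_mode Q0 gl; have [c' c1'] := normalized_mode Q0 gl'.
set p := (fun v => c * mode Q l v) in c1; set q := (fun v => c' * mode Q l' v) in c1'.
pose H := hamiltonian e (double_well R x y) Q.
have Hsym := hamiltonian_sym eg (double_well R x y) Q.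
have Hp v : app H p v = (1 - l) * p v by rewrite /p appZ mode_eigen// mulrCA.
have Hq v : app H q v = (1 - l') * q v by rewrite /q appZ mode_eigen// mulrCA.
have pq : dot p q = 0.
  have E := dot_app_sym p q Hsym.
  move: E; rewrite (_ : app _ q = (fun v => (1 - l') * q v)); last exact/funext.
  rewrite (_ : app _ p = (fun v => (1 - l) * p v)); last exact/funext.
  rewrite (dotZl (1 - l)) (dotZr (1 - l')) => E; apply/eqP.
  have /eqP : (l - l') * dot p q = 0 by rewrite mulrBl; lra.
  by rewrite mulf_eq0 subr_eq0 gt_eqF.
(* Here [z >= Q / 2] costs a factor 4, and the target [delta^2 / 2] a factor 2: this is the 8 in the
   hypothesis on [Q]. *)
have small z : Q / 2 <= z -> K ^+ 3 / z ^+ 2 <= delta ^+ 2 / 2.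
  move=> Qz; have z0 : 0 < z by lra.
  rewrite ler_pdivrMr ?exprn_gt0//.
  have := sqr_ge0 delta; have : Q ^+ 2 <= 4 * z ^+ 2 by nra.
  by move: Qd; move: (K ^+ 3) (delta ^+ 2) (Q ^+ 2) (z ^+ 2) => *; nra.
have pw := mode_concentrated Ll c1 Hp; have qw := mode_concentrated Ll' c1' Hq.
have sl := small l; have sl' := small l'.
have py : p y = well_defect Q x l / res x y l * p x.
  by rewrite /p mode_y// mulrCA.
have -> : cos ((l - l') * t) = cos ((1 - l) * t - (1 - l') * t).
  by rewrite -cosN; congr cos; ring.
apply: (two_mode_ratio Hsym t xy Hp Hq c1 c1' pq d01 _ _ py (ratio_kappa gl D)).
  by apply: le_trans pw; rewrite lerD2l lerN2; apply: sl; lra.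
by apply: le_trans qw; rewrite lerD2l lerN2; apply: sl'; lra.
Qed.

End WellModes.

(** * From eigenvector ratios to the size of the gap *)

Section GapBounds.
Variable R : realType.

(** With [u = |r|] the equation gives [|u^2 - 1| <= k u], which excludes both small and large [u].
    Hence for bounded [kappa] the well defect at each eigenvalue is comparable to the coupling. *)
Lemma ratio_bounds (r kap k : R) : r ^+ 2 - 1 = kap * r -> `|kap| <= k ->
  (k + 1)^-1 <= `|r| <= k + 1.
Proof.
move=> rk kk; have k0 : 0 <= k := le_trans (normr_ge0 _) kk.
have E : `| `|r| ^+ 2 - 1 | <= k * `|r|.
  by rewrite real_normK ?num_real// rk normrM ler_wpM2r.
have core (u : R) : 0 <= u -> - (k * u) <= u ^+ 2 - 1 <= k * u ->
    (k + 1)^-1 <= u <= k + 1.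
  move=> u0 /andP[E1 E2]; apply/andP; split.
    rewrite -[leLHS]mul1r ler_pdivrMr; last by lra.
    rewrite leNgt; apply/negP => uk.
    have u1 : u < 1 by have := mulr_ge0 u0 k0; lra.
    by nra.
  by rewrite leNgt; apply/negP => uk; nra.
by apply: core; rewrite -?ler_norml.
Qed.

(* [X] stands for [Q^(d-1)] and [E] for [2^(d+1)]. *)
Lemma gap_bounds (gap D l l' g g' r r' Q k beta X E : R) :
  0 < Q -> 0 < X -> 1 <= E -> 0 < beta -> 0 <= k -> 0 < gap ->
  Q / 2 <= l <= 2 * Q -> Q / 2 <= l' <= 2 * Q ->
  1 / 2 / (l * l') <= D <= 4 / (l * l') ->
  beta / 2 <= g * (E * (X * Q ^+ 2)) -> g * (X * Q ^+ 2) <= 2 * beta * E ->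
  0 <= g' -> g' * (X * Q ^+ 2) <= 2 * beta * E ->
  (k + 1)^-1 <= r <= k + 1 -> (k + 1)^-1 <= r' <= k + 1 ->
  gap * D = r * g + r' * g' ->
  beta / (32 * (k + 1) * E) <= gap * X <= 32 * (k + 1) * beta * E.
Proof.
move=> Q0 X0 E1 b0 k0 gap0 /andP[lQ lQ2] /andP[l'Q l'Q2] /andP[D1 D2] g1 g2 g'0 g'2.
move=> /andP[r1 r2] /andP[r'1 r'2] gD.
have ll : 0 < l * l' by rewrite mulr_gt0//; lra.
have ki0 : 0 < (k + 1)^-1 by rewrite invr_gt0; lra.
have g0 : 0 <= g.
  rewrite leNgt; apply/negP => gn; have : g * (E * (X * Q ^+ 2)) <= 0.
    by rewrite nmulr_rle0// !mulr_ge0 ?sqr_ge0 ?(ltW X0)//; lra.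
  by lra.
have llQ : l * l' <= 4 * Q ^+ 2 by nra.
have Qll : Q ^+ 2 <= 4 * (l * l') by nra.
apply/andP; split.
  have A : r * g * (l * l') <= 4 * gap.
    rewrite -ler_pdivlMr//.
    have : r * g <= gap * D by rewrite gD lerDl mulr_ge0//; lra.
    move/le_trans; apply; rewrite [leRHS](_ : _ = gap * (4 / (l * l'))); last by ring.
    by rewrite ler_pM2l.
  have B : beta / 2 <= g * (l * l') * (4 * E * X).
    apply: le_trans g1 _; rewrite [leRHS](_ : _ = g * (E * (X * (4 * (l * l'))))); last by ring.
    by rewrite !ler_wpM2l//; lra.
  rewrite ler_pdivrMr; last by rewrite !mulr_gt0//; lra.
  have C : g * (l * l') <= (k + 1) * (4 * gap).
    apply: le_trans (ler_wpM2l (_ : 0 <= k + 1) A); last by lra.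
    have : 1 <= (k + 1) * r by rewrite -ler_pdivrMl ?mulr1//; lra.
    have : 0 <= g * (l * l') by rewrite mulr_ge0// ltW.
    move=> w0 kr; rewrite [leRHS](_ : _ = (k + 1) * r * (g * (l * l'))); last by ring.
    by rewrite ler_peMl.
  have EX : 0 <= 4 * E * X by rewrite !mulr_ge0//; lra.
  have := le_trans B (ler_wpM2r EX C).
  by move: (k + 1) => ?; lra.
have A : gap <= 2 * (l * l') * (r * g + r' * g').
  rewrite -gD -[leLHS]mulr1 [leRHS](_ : _ = gap * (2 * (l * l') * D)); last by ring.
  rewrite ler_pM2l//; move: D1; rewrite ler_pdivrMr// => D1.
  by lra.
have rg : r * g <= (k + 1) * g by rewrite ler_wpM2r.
have rg' : r' * g' <= (k + 1) * g' by rewrite ler_wpM2r.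
have B : gap <= 8 * Q ^+ 2 * ((k + 1) * (g + g')).
  apply: le_trans A _; apply: ler_pM; [by lra| |by lra|by rewrite mulrDr lerD].
  by rewrite addr_ge0// mulr_ge0//; lra.
apply: le_trans (ler_wpM2r (ltW X0) B) _.
rewrite [leLHS](_ : _ = 8 * (k + 1) * (g * (X * Q ^+ 2) + g' * (X * Q ^+ 2))); last by ring.
rewrite [leRHS](_ : _ = 8 * (k + 1) * (2 * beta * E + 2 * beta * E)); last by ring.
by apply: ler_wpM2l; [lra|exact: lerD].
Qed.

End GapBounds.

(** * Asymptotics of coupling and detuning, and the resulting time profile *)

Section Asymptotics.
Variables (R : realType) (T : finType) (e : rel T) (x y : T) (d : nat).
Hypotheses (eg : simple_graph e) (xy : x != y) (xyd : graph_dist e x y d).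
Notation N := (nadj R e).
Notation K := (opsize N).
Notation L := (cutoff N).
Variable s : R -> T -> T -> R.
Hypothesis sP : forall l q, resolves N (Num.max l L) q (s l q).
Notation res := (res s).
Notation kappa := (kappa x y s).

(** Total weight of the shortest walks from [x] to [y]: the first nonzero coefficient in the
    expansion of [res x y]. *)
Definition beta : R := mpow N d x y.

Lemma beta_gt0 : 0 < beta.
Proof. by apply: mpow_nadj_gt0 => //; case: xyd. Qed.

Lemma dist_gt0 : (0 < d)%N.
Proof.
case: d xyd => // -[[p [sp _ lp]] _]; move: lp xy.
by rewrite (size0nil sp) /= => ->; rewrite eqxx.
Qed.

(** The expansion is taken to order [m.+1], so that its last term becomes the limit and the error is
    [O(1/l)]. *)
Lemma scaled_expansion p q m l : L <= l ->
  `|(res p q l - \sum_(0 <= k < m) mpow N k p q / l ^+ k.+1) * l ^+ m.+1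
     - mpow N m p q| <= 2 * K ^+ m.+1 / l.
Proof.
move=> Ll; have [l16 _] := cutoff_ge Ll; have l0 : 0 < l by lra.
have lm : 0 < l ^+ m.+1 by exact: exprn_gt0.
have := resolvent_expansion m.+1 p Ll (resolves_family sP q Ll).
rewrite big_nat_recr//= -/(res p q l) opprD addrA => E.
have -> : (res p q l - \sum_(0 <= k < m) mpow N k p q / l ^+ k.+1) * l ^+ m.+1
    - mpow N m p q = (res p q l - \sum_(0 <= k < m) mpow N k p q / l ^+ k.+1 -
        mpow N m p q / l ^+ m.+1) * l ^+ m.+1.
  by rewrite [RHS]mulrBl divfK// gt_eqF.
rewrite normrM (ger0_norm (ltW lm)).
have := ler_wpM2r (ltW lm) E.
suff -> : 2 * K ^+ m.+1 / l ^+ m.+2 * l ^+ m.+1 = 2 * K ^+ m.+1 / l by [].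
by rewrite [l ^+ m.+2]exprS; field; rewrite !gt_eqF.
Qed.

Lemma coupling_asymptotics l : L <= l ->
  `|res x y l * l ^+ d.+1 - beta| <= 2 * K ^+ d.+1 / l.
Proof.
move=> Ll; have := scaled_expansion x y d Ll.
rewrite big_nat_cond big1 ?subr0// => k /andP[/andP[_ kd] _].
by rewrite mpow_nadj_eq0 ?mul0r//; case: xyd => _; apply.
Qed.

Lemma detuning_asymptotics m l : L <= l ->
  (forall k, (k < m)%N -> mpow N k y y = mpow N k x x) ->
  `|(res y y l - res x x l) * l ^+ m.+1 - (mpow N m y y - mpow N m x x)|
    <= 4 * K ^+ m.+1 / l.
Proof.
move=> Ll eqN; have := scaled_expansion y y m Ll; have := scaled_expansion x x m Ll.
have -> : \sum_(0 <= k < m) mpow N k y y / l ^+ k.+1 =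
    \sum_(0 <= k < m) mpow N k x x / l ^+ k.+1.
  rewrite big_nat_cond [RHS]big_nat_cond; apply: eq_bigr => k /andP[/andP[_ km] _].
  by rewrite eqN.
move: (\sum_(0 <= k < m) _) => S Ex Ey.
rewrite (_ : _ - _ = ((res y y l - S) * l ^+ m.+1 - mpow N m y y) -
   ((res x x l - S) * l ^+ m.+1 - mpow N m x x)); last by ring.
by apply: le_trans (ler_normB _ _) _; lra.
Qed.

Lemma coupling_bounds : exists M, forall l, M <= l ->
  [/\ L <= l, beta / 2 <= res x y l * l ^+ d.+1 & res x y l * l ^+ d.+1 <= 2 * beta].
Proof.
have b0 := beta_gt0.
exists (Num.max L (4 * K ^+ d.+1 / beta)) => l; rewrite ge_max => /andP[Ll Cl].
have [l16 _] := cutoff_ge Ll; have l0 : 0 < l by lra.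
have C : 2 * K ^+ d.+1 / l <= beta / 2.
  by rewrite ler_pdivrMr//; move: Cl; rewrite ler_pdivrMr//; lra.
have := coupling_asymptotics Ll; rewrite ler_norml => /andP[? ?].
by split=> //; lra.
Qed.

Lemma kappa_scaled m l : 0 < l -> kappa l =
  (res y y l - res x x l) * l ^+ m.+1 / (res x y l * l ^+ m.+1).
Proof.
by move=> l0; rewrite /kappa -mulf_div divff ?mulr1// gt_eqF// exprn_gt0.
Qed.

Definition kappa_lim : R := (mpow N d y y - mpow N d x x) / beta.

Lemma kappa_cvg (eps : R) : 0 < eps ->
  (forall k, (k < d)%N -> mpow N k y y = mpow N k x x) ->
  exists M, forall l, M <= l -> `|kappa l - kappa_lim| <= eps.
Proof.
move=> eps0 eqN; have b0 := beta_gt0; have [M MP] := coupling_bounds.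
pose al := mpow N d y y - mpow N d x x; pose C := 4 * K ^+ d.+1.
(* The difference of the two quotients has numerator at most [C / l * (beta + |al|)] and denominator
   at least [beta^2 / 2]; this threshold brings it below [eps]. *)
exists (Num.max M (2 * C * (beta + `|al|) / (beta ^+ 2 * eps))) => l.
rewrite ge_max => /andP[/MP[Ll g1 g2] lC].
have [l16 _] := cutoff_ge Ll; have l0 : 0 < l by lra.
rewrite (kappa_scaled d)// /kappa_lim -/al.
have E1 := detuning_asymptotics Ll eqN; rewrite -/al -/C in E1.
have C0 : 0 <= C by rewrite mulr_ge0// exprn_ge0//; have := opsize_ge1 N; lra.
have E2 : `|res x y l * l ^+ d.+1 - beta| <= C / l.
  apply: le_trans (coupling_asymptotics Ll) _.
  by rewrite ler_wpM2r ?invr_ge0 ?(ltW l0)//; move: C0; rewrite /C; lra.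
move: ((res y y l - res x x l) * _) (res x y l * _) E1 E2 g1 g2 => A G E1 E2 g1 g2.
have G0 : 0 < G by lra.
have -> : A / G - al / beta = ((A - al) * beta - al * (G - beta)) / (G * beta).
  by field; rewrite !gt_eqF.
rewrite normrM normfV (ger0_norm (_ : 0 <= G * beta)); last by rewrite mulr_ge0 ?ltW.
rewrite ler_pdivrMr ?mulr_gt0//.
apply: (le_trans (y := C / l * (beta + `|al|))).
  apply: le_trans (ler_normB _ _) _; rewrite !normrM (ger0_norm (ltW b0)) mulrDr.
  by apply: lerD; [rewrite ler_wpM2r// ltW|rewrite mulrC ler_wpM2r].
rewrite mulrAC ler_pdivrMr//.
move: lC; rewrite ler_pdivrMr ?mulr_gt0 ?exprn_gt0// => lC.
have : eps * (beta / 2 * beta) * l <= eps * (G * beta) * l.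
  by rewrite ler_pM2r// ler_pM2l// ler_pM2r.
by move: lC; rewrite expr2; lra.
Qed.

(** Let [j] be the first order at which the return weights differ. The detuning is of order
    [l^(-j-1)], the coupling of order [l^(-d-1)], and their quotient grows like [l^(d-j)] with
    [d - j > 0]. *)
Lemma kappa_diverges B : (exists2 k, (k < d)%N & mpow N k y y != mpow N k x x) ->
  exists M, forall l, M <= l -> B <= `|kappa l|.
Proof.
move=> [k0 k0d neq0].
have [j nej minj] := @ex_minnP (fun k => mpow N k y y != mpow N k x x)
  (ex_intro _ k0 neq0).
have jd : (j < d)%N by apply: leq_ltn_trans (minj _ neq0) k0d.
have eqN k : (k < j)%N -> mpow N k y y = mpow N k x x.
  by move=> kj; apply/eqP; apply/negPn/negP => /minj; rewrite leqNgt kj.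
have b0 := beta_gt0; have [M MP] := coupling_bounds.
pose al := mpow N j y y - mpow N j x x; pose C := 4 * K ^+ j.+1.
have al0 : 0 < `|al| by rewrite normr_gt0 subr_eq0.
(* The first threshold keeps the scaled detuning above [|al| / 2]; under the second, one factor [l]
   of [l ^+ (d - j)] outweighs the coupling bound [2 * beta]. *)
exists (Num.max M (Num.max (2 * C / `|al|) (4 * beta * `|B| / `|al|))) => l.
rewrite !ge_max => /andP[/MP[Ll g1 g2] /andP[lC lB]].
have [l16 _] := cutoff_ge Ll; have l0 : 0 < l by lra.
apply: le_trans (ler_norm B) _.
have E1 := detuning_asymptotics Ll eqN; rewrite -/al -/C in E1.
have A2 : `|al| / 2 <= `|(res y y l - res x x l) * l ^+ j.+1|.
  have Cl : C / l <= `|al| / 2.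
    by move: lC; rewrite !ler_pdivrMr//; lra.
  have := ler_distD ((res y y l - res x x l) * l ^+ j.+1) al 0.
  by rewrite !subr0 distrC; lra.
have g0 : 0 < res x y l * l ^+ d.+1 by lra.
rewrite (kappa_scaled d)// normrM normfV (ger0_norm (ltW g0)) ler_pdivlMr//.
apply: (le_trans (y := `|B| * (2 * beta))); first by rewrite ler_wpM2l.
have -> : l ^+ d.+1 = l ^+ j.+1 * l ^+ (d - j) by rewrite -exprD addSn subnKC// ltnW.
rewrite [in leRHS]mulrA normrM.
have lj : l <= `|l ^+ (d - j)|.
  rewrite ger0_norm ?exprn_ge0 ?(ltW l0)//.
  have : (0 < d - j)%N by rewrite subn_gt0.
  case: (d - j)%N => // i _; rewrite exprS -[leLHS]mulr1 ler_pM2l//.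
  by apply: exprn_ege1; lra.
apply: (le_trans (y := `|al| / 2 * l)); last by apply: ler_pM => //; lra.
by move: lB; rewrite ler_pdivrMr//; lra.
Qed.

(** Passing from [l] to [Q] costs a factor 2 per power. The exponent [d.+1] is split as [d.-1 + 2],
    which needs [d > 0]: the part [Q ^+ 2] will cancel the inner product of the resolvent
    columns. *)
Lemma coupling_Q Q l : 0 < Q -> Q / 2 <= l <= 2 * Q ->
  beta / 2 <= res x y l * l ^+ d.+1 -> res x y l * l ^+ d.+1 <= 2 * beta ->
  [/\ 0 < res x y l, beta / 2 <= res x y l * (2 ^+ d.+1 * (Q ^+ d.-1 * Q ^+ 2)) &
      res x y l * (Q ^+ d.-1 * Q ^+ 2) <= 2 * beta * 2 ^+ d.+1].
Proof.
move=> Q0 /andP[Ql lQ] g1 g2; have b0 := beta_gt0; have l0 : 0 < l by lra.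
have -> : Q ^+ d.-1 * Q ^+ 2 = Q ^+ d.+1.
  by rewrite -exprD addn2 prednK// dist_gt0.
have lp : 0 < l ^+ d.+1 by exact: exprn_gt0.
have g0 : 0 < res x y l.
  by rewrite -(pmulr_lgt0 _ lp); lra.
split=> //.
  apply: le_trans g1 _; rewrite -exprMn ler_pM2l//.
  by apply: lerXn2r; rewrite ?nnegrE; lra.
apply: (le_trans (y := res x y l * l ^+ d.+1 * 2 ^+ d.+1)); last first.
  by rewrite ler_pM2r ?exprn_gt0.
rewrite -mulrA -exprMn ler_pM2l//.
by apply: lerXn2r; rewrite ?nnegrE; lra.
Qed.

Lemma small_delta (delta : R) : 0 < delta ->
  exists M, forall Q, M <= Q -> 8 * K ^+ 3 <= delta ^+ 2 * Q ^+ 2.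
Proof.
move=> d0; have K1 := opsize_ge1 N.
have K3 : 0 <= 8 * K ^+ 3 by rewrite mulr_ge0// exprn_ge0//; lra.
have D2 : 0 < delta ^+ 2 by exact: exprn_gt0.
exists (1 + 8 * K ^+ 3 / delta ^+ 2) => Q QM.
rewrite [leRHS]mulrC -ler_pdivrMr//.
have : 0 <= 8 * K ^+ 3 / delta ^+ 2 by rewrite divr_ge0// ltW.
by move: QM; move: (8 * K ^+ 3 / delta ^+ 2) => w; nra.
Qed.

Let amp Q t := amp2 (hamiltonian e (double_well R x y) Q) x y t.

Lemma tunneling_profile :
  (forall k, (k < d)%N -> mpow N k y y = mpow N k x x) ->
  exists c1 c2, [/\ 0 < c1, 0 < c2 & forall eps : R, 0 < eps ->
    exists M, forall Q, M <= Q -> exists gap : R,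
      c1 <= gap * Q ^+ d.-1 <= c2 /\
      forall t, `|amp Q t - 2 / (kappa_lim ^+ 2 + 4) * (1 - cos (gap * t))| <= eps].
Proof.
move=> eqN; have b0 := beta_gt0.
pose k := `|kappa_lim| + 1; have k1 : 1 <= k by rewrite /k lerDr.
exists (beta / (32 * (k + 1) * 2 ^+ d.+1)), (32 * (k + 1) * beta * 2 ^+ d.+1).
have E1 : 1 <= 2 ^+ d.+1 :> R by apply: exprn_ege1; lra.
split.
- by apply: divr_gt0 => //; rewrite !mulr_gt0//; lra.
- by rewrite !mulr_gt0//; lra.
move=> eps eps0.
(* The loss [8 * delta] in [wells_estimate] uses half of [eps]; the other half pays for replacing
   [kappa l] by its limit. *)
pose delta := Num.min 1 (eps / 16).
have d01 : 0 < delta <= 1 by rewrite ge_min lexx lt_min ltr01 divr_gt0.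
have dle : 8 * delta <= eps / 2.
  by have : delta <= eps / 16 by [rewrite ge_min lexx orbT]; lra.
(* Both denominators are at least 4, so [2 / (kappa^2 + 4)] moves by at most
   [2 * eta * 2k / 16 <= eps / 4], and [1 - cos] is at most 2. The bound [eta <= 1] makes [k]
   dominate [kappa]. *)
pose eta := Num.min 1 (eps / k).
have eta0 : 0 < eta by rewrite lt_min ltr01 divr_gt0//; lra.
have [M1 P1] := kappa_cvg eta0 eqN.
have [M2 P2] := coupling_bounds.
have [|M3 P3] := small_delta (delta := delta); first by case/andP: d01.
(* Eigenvalues are only known to be at least [Q / 2], so thresholds in [l] are doubled. *)
exists (Num.max (2 * M1) (Num.max (2 * M2) (Num.max M3 (2 * L)))) => Q.
rewrite !ge_max => /andP[QM1 /andP[QM2 /andP[QM3 QL]]].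
have [L16 _] := cutoff_ge (lexx L); have Q0 : 0 < Q by lra.
have X0 : 0 < Q ^+ d.-1 by exact: exprn_gt0.
have cq z : Q / 2 <= z <= 2 * Q ->
  [/\ 0 < res x y z, beta / 2 <= res x y z * (2 ^+ d.+1 * (Q ^+ d.-1 * Q ^+ 2)) &
      res x y z * (Q ^+ d.-1 * Q ^+ 2) <= 2 * beta * 2 ^+ d.+1].
  move=> zQ; have /P2[_ g1 g2] : M2 <= z by case/andP: zQ; lra.
  exact: coupling_Q.
have [l [l' [[Ql' l'l lQ] [[D D' h h'] A]]]] :=
  wells_estimate eg xy sP QL d01 (P3 _ QM3) (fun z zQ => let: And3 g _ _ := cq z zQ in g).
have lI : Q / 2 <= l <= 2 * Q by apply/andP; split; lra.
have lI' : Q / 2 <= l' <= 2 * Q by apply/andP; split; lra.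
have Ll : L <= l by lra.
have Ll' : L <= l' by lra.
have [g g1 g2] := cq _ lI; have [g' g1' g2'] := cq _ lI'.
have kl z : Q / 2 <= z -> `|kappa z - kappa_lim| <= eta by move=> ?; apply: P1; lra.
have etal : eta <= 1 by rewrite ge_min lexx.
have kk z : Q / 2 <= z -> `|kappa z| <= k.
  move=> /kl zk; rewrite -[kappa z](subrK kappa_lim).
  by apply: le_trans (ler_normD _ _) _; rewrite /k; lra.
have lQ2 : Q / 2 <= l by lra.
have r := ratio_bounds (ratio_kappa (lt0r_neq0 g) D) (kk _ lQ2).
have r' := ratio_bounds (ratio_kappa (lt0r_neq0 g') D') (kk _ Ql').
exists (l - l'); split.
  move: r r'; rewrite ger0_norm ?divr_ge0 ?(ltW h) ?(ltW g)//.
  rewrite ler0_norm ?nmulr_rle0 ?invr_ge0 ?(ltW g')// => r r'.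
  (* The defects are [r g] at [l] and [r' g'] at [l']. As the second ratio is negative, the
     difference is the sum [r g + |r'| g'], and the gap is bounded below. *)
  have gD := well_defect_diff x eg sP Q Ll Ll'.
  apply: (gap_bounds (D := dot (s l x) (s l' x)) Q0 X0 E1 b0 _ _ lI lI' _
    g1 g2 (ltW g') g2' r r').
  - by lra.
  - by rewrite subr_gt0.
  - exact: resolvent_dot_bounds (resolves_family sP x Ll) (resolves_family sP x Ll').
  - by rewrite -gD mulNr !divfK ?gt_eqF.
move=> t; rewrite /amp.
rewrite (_ : _ - _ = (amp2 (hamiltonian e (double_well R x y) Q) x y t -
   2 / (kappa l ^+ 2 + 4) * (1 - cos ((l - l') * t))) +
   (2 / (kappa l ^+ 2 + 4) - 2 / (kappa_lim ^+ 2 + 4)) * (1 - cos ((l - l') * t)));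
  last by ring.
apply: le_trans (ler_normD _ _) _; have := A t.
suff : `|(2 / (kappa l ^+ 2 + 4) - 2 / (kappa_lim ^+ 2 + 4)) *
   (1 - cos ((l - l') * t))| <= eps / 2 by lra.
have p1 : 0 < kappa l ^+ 2 + 4 by have := sqr_ge0 (kappa l); lra.
have p2 : 0 < kappa_lim ^+ 2 + 4 by have := sqr_ge0 kappa_lim; lra.
rewrite normrM (_ : eps / 2 = eps / 4 * 2); last by field.
apply: ler_pM => //; last first.
  by apply: le_trans (ler_normB _ _) _; rewrite normr1; have := cos_max ((l - l') * t); lra.
have -> : 2 / (kappa l ^+ 2 + 4) - 2 / (kappa_lim ^+ 2 + 4) =
   2 * ((kappa_lim - kappa l) * (kappa_lim + kappa l)) /
     ((kappa l ^+ 2 + 4) * (kappa_lim ^+ 2 + 4)) by field; rewrite !gt_eqF.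
rewrite normrM normfV (ger0_norm (ltW (mulr_gt0 p1 p2))) ler_pdivrMr ?mulr_gt0//.
have pp : 16 <= (kappa l ^+ 2 + 4) * (kappa_lim ^+ 2 + 4).
  rewrite (_ : 16 = 4 * 4); last by ring.
  by apply: ler_pM => //; rewrite lerDr sqr_ge0.
apply: (le_trans (y := eps / 4 * 16)); last by rewrite ler_pM2l//; lra.
have e2 : eta * k <= eps.
  rewrite -ler_pdivlMr; last by lra.
  by rewrite ge_min lexx orbT.
have T1 := kl _ lQ2; have T2 := kk _ lQ2.
rewrite normrM normrM (ger0_norm (_ : 0 <= 2))// distrC.
have S : `|kappa_lim + kappa l| <= 2 * k.
  by apply: le_trans (ler_normD _ _) _; rewrite {1}/k in T2 *; rewrite /k; lra.
have : `|kappa l - kappa_lim| * `|kappa_lim + kappa l| <= eta * (2 * k) by apply: ler_pM.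
by lra.
Qed.

Lemma no_tunneling_profile :
  (exists2 k, (k < d)%N & mpow N k y y != mpow N k x x) ->
  forall eps : R, 0 < eps -> exists M, forall Q, M <= Q -> forall t, amp Q t <= eps.
Proof.
move=> neN eps eps0.
pose delta := Num.min 1 (eps / 16).
have d01 : 0 < delta <= 1 by rewrite ge_min lexx lt_min ltr01 divr_gt0.
have dle : 8 * delta <= eps / 2.
  by have : delta <= eps / 16 by [rewrite ge_min lexx orbT]; lra.
(* From [|kappa| >= 1 + 8 / eps] follows [kappa^2 >= 8 / eps], so the amplitude [2 / (kappa^2 + 4)]
   is at most [eps / 4] and the oscillation at most [eps / 2] at all times. *)
have [M1 P1] := kappa_diverges (1 + 8 / eps) neN.
have [M2 P2] := coupling_bounds.
have [|M3 P3] := small_delta (delta := delta); first by case/andP: d01.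
exists (Num.max (2 * M1) (Num.max (2 * M2) (Num.max M3 (2 * L)))) => Q.
rewrite !ge_max => /andP[QM1 /andP[QM2 /andP[QM3 QL]]] t.
have [L16 _] := cutoff_ge (lexx L); have Q0 : 0 < Q by lra.
have cq z : Q / 2 <= z <= 2 * Q -> 0 < res x y z.
  move=> zQ; have /P2[_ g1 g2] : M2 <= z by case/andP: zQ; lra.
  by have [] := coupling_Q Q0 zQ g1 g2.
have [l [l' [[Ql' l'l lQ] [_ A]]]] :=
  wells_estimate eg xy sP QL d01 (P3 _ QM3) cq.
have Bk : 1 + 8 / eps <= `|kappa l| by apply: P1; lra.
have e8 : 0 < 8 / eps by rewrite divr_gt0.
have ksq : 8 / eps <= kappa l ^+ 2 + 4.
  rewrite -[kappa l ^+ 2]real_normK ?num_real//.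
  by move: (8 / eps) (`|kappa l|) e8 Bk => u v *; nra.
have p1 : 0 < kappa l ^+ 2 + 4 by have := sqr_ge0 (kappa l); lra.
have : 2 / (kappa l ^+ 2 + 4) * (1 - cos ((l - l') * t)) <= eps / 2.
  rewrite (_ : eps / 2 = eps / 4 * 2); last by field.
  have := cos_max ((l - l') * t); rewrite ler_norml => /andP[c1 c2].
  apply: ler_pM; [by rewrite divr_ge0// ltW|by lra| |by lra].
  rewrite ler_pdivrMr//; move: ksq; rewrite ler_pdivrMr//; lra.
by have := A t; rewrite ler_norml /amp => /andP[_ ?]; lra.
Qed.

End Asymptotics.

(** * Lower limits at infinity in the extended reals *)

Section Liminf.
Variable R : realType.
Implicit Types (F : R -> \bar R) (a : \bar R).

Lemma liminf_pinfty_le F a : (exists M, forall Q, M <= Q -> (F Q <= a)%E) ->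
  (liminf_pinfty F <= a)%E.
Proof.
move=> [M FM]; apply: ge_ereal_sup => _ [M' _ <-].
apply: (@le_trans _ _ (F (Num.max M M'))); last by apply: FM; rewrite le_max lexx.
by apply: ereal_inf_lbound; exists (Num.max M M') => //=; rewrite le_max lexx orbT.
Qed.

Lemma liminf_pinfty_ge F a : (exists M, forall Q, M <= Q -> (a <= F Q)%E) ->
  (a <= liminf_pinfty F)%E.
Proof.
move=> [M FM]; apply: (@le_trans _ _ (ereal_inf [set F Q | Q in [set Q | M <= Q]])).
  by apply: le_ereal_inf_tmp => _ [Q /= MQ <-]; exact: FM.
by apply: ereal_sup_ubound; exists M.
Qed.

Lemma liminf_pinfty_eq F (tau : R) : (forall eps : R, 0 < eps ->
    exists M, forall Q, M <= Q -> ((tau - eps)%:E <= F Q <= (tau + eps)%:E)%E) ->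
  liminf_pinfty F = tau%:E.
Proof.
move=> Ft; apply/eqP; rewrite eq_le; apply/andP; split.
  apply/lee_addgt0Pr => eps /Ft[M FM]; apply: liminf_pinfty_le; exists M => Q.
  by move=> /FM/andP[].
apply/lee_subgt0Pr => eps /Ft[M FM]; apply: liminf_pinfty_ge; exists M => Q.
by move=> /FM/andP[].
Qed.

End Liminf.

(** * Peak value and time scale of a slow oscillation *)

Section OscillationProfile.
Variables (R : realType) (amp : R -> R -> R) (tau c1 c2 : R) (n : nat).
Hypotheses (tau0 : 0 < tau) (c10 : 0 < c1) (c20 : 0 < c2).
Hypothesis profile : forall eps : R, 0 < eps ->
  exists M, forall Q, M <= Q -> exists gap : R,
    c1 <= gap * Q ^+ n <= c2 /\
    forall t, `|amp Q t - tau / 2 * (1 - cos (gap * t))| <= eps.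

(** The peak is reached at [pi / gap], which is at most [pi / c1 * Q ^+ n]. Allowing any larger set
    of times covers both the tunneling coefficient and tunneling within a given time. *)
Lemma liminf_sup_profile (A : R -> set R) :
  (forall Q (t : R), 0 <= t <= pi / c1 * Q ^+ n -> A Q t) ->
  liminf_pinfty (fun Q => ereal_sup [set (amp Q t)%:E | t in A Q]) = tau%:E.
Proof.
move=> At; have taup := tau0; apply: liminf_pinfty_eq => eps /profile[M MP].
exists (Num.max M 1) => Q; rewrite ge_max => /andP[/MP[gap [/andP[g1 g2] P]] Q1].
have Q0 : 0 < Q ^+ n by rewrite exprn_gt0//; lra.
have gap0 : 0 < gap by rewrite -(pmulr_lgt0 _ Q0); exact: lt_le_trans g1.
apply/andP; split; last first.
  apply: ge_ereal_sup => _ [t _ <-]; rewrite lee_fin.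
  have := P t; rewrite ler_norml => /andP[_ H].
  have := cos_max (gap * t); rewrite ler_norml => /andP[C _].
  have : 0 <= tau * (1 + cos (gap * t)) by rewrite mulr_ge0//; lra.
  by lra.
apply: (@le_trans _ _ (amp Q (pi / gap))%:E).
  rewrite lee_fin; have := P (pi / gap).
  by rewrite mulrCA divff ?gt_eqF// mulr1 cospi ler_norml => /andP[H _]; lra.
apply: ereal_sup_ubound; exists (pi / gap) => //; apply: At.
rewrite divr_ge0 ?pi_ge0 ?(ltW gap0)//= -mulrA ler_pM2l ?pi_gt0//.
by rewrite mulrC ler_pdivlMr// mulrC ler_pdivrMr// mulrC.
Qed.

(** Up to time [eta / (2 * c2) * Q ^+ n] the phase stays below [eta], where the cosine is at least
    1/2. The profile is then at most [tau / 4], and an error [tau / 4] still leaves only half of the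
    peak. *)
Lemma liminf_sup_profile_littleo (f : R -> R) :
  littleo_pinfty f (fun Q => Q ^+ n) ->
  (liminf_pinfty (fun Q =>
     ereal_sup [set (amp Q t)%:E | t in [set t | (0 <= t <= f Q)%R]]) <= (tau / 2)%:E)%E.
Proof.
move=> fo; have taup := tau0.
have [eta eta0 cosP] : exists2 eta : R, 0 < eta &
    forall u : R, 0 <= u < eta -> 1 / 2 <= cos u.
  have /cvgrPdist_lt/(_ (1 / 2)) : cos u @[u --> (0 : R)] --> cos 0.
    exact: continuous_cos.
  rewrite cos0 => /(_ _)[|eta /= eta0 H]; first by lra.
  exists eta => // u /andP[u0 ue]; have := H u; rewrite /= sub0r normrN ger0_norm//.
  by move=> /(_ ue); rewrite ltr_norml => /andP[_ ?]; lra.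
have [|M1 P1] := fo (eta / (2 * c2)); first by rewrite divr_gt0// mulr_gt0.
have [|M2 P2] := profile (eps := tau / 4); first by lra.
apply: liminf_pinfty_le; exists (Num.max (Num.max M1 M2) 1) => Q.
rewrite !ge_max => /andP[/andP[/P1 fQ /P2[gap [/andP[g1 g2] P]]] Q1].
have Q0 : 0 < Q ^+ n by rewrite exprn_gt0//; lra.
have gap0 : 0 < gap by rewrite -(pmulr_lgt0 _ Q0); exact: lt_le_trans g1.
apply: ge_ereal_sup => _ [t /= /andP[t0 tf] <-]; rewrite lee_fin.
have tb : t <= eta / (2 * c2) * Q ^+ n.
  apply: le_trans tf _; apply: le_trans (ler_norm _) _; apply: le_trans fQ _.
  by rewrite (ger0_norm (ltW Q0)).
have gt : gap * t < eta.
  apply: le_lt_trans (ler_wpM2l (ltW gap0) tb) _.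
  rewrite [ltLHS](_ : _ = eta / (2 * c2) * (gap * Q ^+ n)); last by ring.
  apply: (@le_lt_trans _ _ (eta / (2 * c2) * c2)).
    by rewrite ler_pM2l// divr_gt0// mulr_gt0.
  rewrite (_ : _ * c2 = eta / 2); first by lra.
  by field; rewrite gt_eqF.
have C : 1 / 2 <= cos (gap * t) by apply: cosP; rewrite gt mulr_ge0// ltW.
have := P t; rewrite ler_norml => /andP[_ H].
have : 0 <= tau * (cos (gap * t) - 1 / 2) by rewrite mulr_ge0//; lra.
by lra.
Qed.

End OscillationProfile.

(** * Tunneling coefficient and tunneling time of the double well *)

Section Tunneling.
Variables (R : realType) (T : finType) (e : rel T) (x y : T) (d : nat).
Hypotheses (eg : simple_graph e) (ec : connected_graph e) (xy : x != y).
Hypothesis xyd : graph_dist e x y d.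
Notation W := (double_well R x y).
Notation N := (nadj R e).

Lemma connected_deg_gt0 v w : v != w -> (0 < deg e v)%N.
Proof.
move=> vw; have /connectP[[|z p] /= vp lp] := ec v w.
  by rewrite lp eqxx in vw.
by case/andP: vp => vz _; exact: deg_gt0 vz.
Qed.

Lemma PR_x_nadj k : PR R e x k = mpow N k x x.
Proof. by apply: PR_nadj => //; exact: connected_deg_gt0 xy. Qed.

Lemma PR_y_nadj k : PR R e y k = mpow N k y y.
Proof. by apply: PR_nadj => //; apply: (@connected_deg_gt0 y x); rewrite eq_sym. Qed.

Lemma resolvent_family : exists s : R -> T -> T -> R,
  forall l q, resolves N (Num.max l (cutoff N)) q (s l q).
Proof.
have /choice[f fP] : forall lq : R * T,
    exists s, resolves N (Num.max lq.1 (cutoff N)) lq.2 s.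
  by move=> lq; apply: resolvent_exists; rewrite le_max lexx orbT.
by exists (fun l q => f (l, q)) => l q; exact: (fP (l, q)).
Qed.

(** As [d] is positive, agreement up to [d.-1] means agreement at exactly the orders preceding the
    leading term of the coupling. *)
Lemma cospectral_predP : cospectral R e d.-1 x y <->
  forall k, (k < d)%N -> mpow N k y y = mpow N k x x.
Proof.
have d0 := dist_gt0 xy xyd.
split=> H k kd; first by rewrite -PR_x_nadj -PR_y_nadj H// -ltnS prednK.
by rewrite PR_x_nadj PR_y_nadj H// -(prednK d0) ltnS.
Qed.

Lemma amp2_well_sym Q : amp2 (hamiltonian e W Q) y x = amp2 (hamiltonian e W Q) x y.
Proof. by apply/funext => t; apply: amp2_sym; exact: hamiltonian_sym. Qed.

Lemma TC_sym : TC e W y x = TC e W x y.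
Proof. by rewrite /TC; congr liminf_pinfty; apply/funext => Q; rewrite amp2_well_sym. Qed.

Lemma tunnels_within_sym f : tunnels_within e W y x f = tunnels_within e W x y f.
Proof.
rewrite /tunnels_within TC_sym; congr (_ = liminf_pinfty _).
by apply/funext => Q; rewrite amp2_well_sym.
Qed.

Lemma tunneling_time_Theta_sym g :
  tunneling_time_Theta e W x y g -> tunneling_time_Theta e W y x g.
Proof.
move=> [[f [fg ft]] no]; split.
  by exists f; rewrite tunnels_within_sym.
by move=> h hg; rewrite tunnels_within_sym; exact: no.
Qed.

(** The peak of [2 / (kappa^2 + 4) * (1 - cos)] at the limit of [kappa]; it equals 1 exactly when
    [kappa_lim] is 0. *)
Definition tau : R := 4 / (kappa_lim R e x y d ^+ 2 + 4).

Lemma tau_gt0 : 0 < tau.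
Proof. by apply: divr_gt0 => //; have := sqr_ge0 (kappa_lim R e x y d); lra. Qed.

Lemma tunneling_cospectral : cospectral R e d.-1 x y ->
  TC e W x y = tau%:E /\ tunneling_time_Theta e W x y (fun Q => Q ^+ d.-1).
Proof.
move=> /cospectral_predP eqN; have [s sP] := resolvent_family.
have [c1 [c2 [c10 c20 P0]]] := tunneling_profile eg xy xyd sP eqN.
have tauE : tau / 2 = 2 / (kappa_lim R e x y d ^+ 2 + 4).
  rewrite /tau; field.
  by rewrite gt_eqF//; have := sqr_ge0 (kappa_lim R e x y d); lra.
rewrite -tauE in P0.
have TCt : TC e W x y = tau%:E.
  by apply: (liminf_sup_profile tau_gt0 c10 P0) => Q t /andP[].
split=> //; split.
  exists (fun Q => pi / c1 * Q ^+ d.-1); split.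
    exists (pi / c1), 0 => Q _; rewrite normrM ger0_norm// divr_ge0 ?pi_ge0//.
    exact: ltW.
  rewrite /tunnels_within TCt; apply/esym.
  exact: (liminf_sup_profile tau_gt0 c10 P0).
move=> f fo; rewrite /tunnels_within TCt => E.
have := liminf_sup_profile_littleo tau_gt0 c10 c20 P0 fo.
by rewrite -E lee_fin; have := tau_gt0; lra.
Qed.

Lemma no_tunneling : ~ cospectral R e d.-1 x y -> TC e W x y = 0%E.
Proof.
move=> ncos; have [s sP] := resolvent_family.
have neN : exists2 k, (k < d)%N & mpow N k y y != mpow N k x x.
  apply: contrapT => nex; apply: ncos; apply/cospectral_predP => k kd.
  by apply/eqP/negPn/negP => neq; apply: nex; exists k.
apply: liminf_pinfty_eq => eps eps0.
have [M MP] := no_tunneling_profile eg xy xyd sP neN eps0.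
exists M => Q MQ; apply/andP; split.
  (* The time 0 witnesses that the supremum is nonnegative. *)
  apply: (@le_trans _ _ (amp2 (hamiltonian e W Q) x y 0)%:E).
    rewrite lee_fin (@le_trans _ _ 0)//; first by lra.
    by rewrite /amp2 addr_ge0// sqr_ge0.
  by apply: ereal_sup_ubound; exists 0 => /=.
by apply: ge_ereal_sup => _ [t _ <-]; rewrite lee_fin add0r; exact: MP.
Qed.

End Tunneling.

Theorem theorem1 (R : realType) (T : finType) (e : rel T) (x y : T) (d : nat)
  (Hg : simple_graph e) (Hc : connected_graph e) (Hxy : x != y)
  (Hd : graph_dist e x y d) :
  let W := @double_well R T x y in
  (* case (1): co(x,y) >= d *)
  (@cospectral R T e d x y ->
     TC e W x y = 1%E /\ TC e W y x = 1%E) /\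
  (* case (2): co(x,y) = d - 1 *)
  ((@cospectral R T e d.-1 x y /\ ~ @cospectral R T e d x y) ->
     ((0 < TC e W x y)%E /\ (TC e W x y < 1)%E) /\
     ((0 < TC e W y x)%E /\ (TC e W y x < 1)%E)) /\
  (* case (3): co(x,y) < d - 1 *)
  (~ @cospectral R T e d.-1 x y ->
     TC e W x y = 0%E /\ TC e W y x = 0%E) /\
  (* tunneling time Theta(Q^(d-1)) whenever there is tunneling *)
  (@cospectral R T e d.-1 x y ->
     tunneling_time_Theta e W x y (fun Q => Q ^+ d.-1) /\
     tunneling_time_Theta e W y x (fun Q => Q ^+ d.-1)).
Proof.
move=> W.
have tunnel := tunneling_cospectral Hg Hc Hxy Hd (R := R).
have b0 := beta_gt0 R Hg Hd.
rewrite !(TC_sym R x y Hg).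
split; [|split; [|split]].
- move=> cosd; suff -> : TC e W x y = 1%E by [].
  have [|-> _] := tunnel; first by move=> k kd; apply: cosd; rewrite (leq_trans kd)// leq_pred.
  have := cosd d (leqnn d); rewrite (PR_x_nadj R Hg Hc Hxy) (PR_y_nadj R Hg Hc Hxy) => E.
  by rewrite /tau /kappa_lim E subrr mul0r expr0n /= add0r divff.
- move=> [cosp ncos]; have [-> _] := tunnel cosp.
  suff : (0 < (tau R e x y d)%:E)%E /\ ((tau R e x y d)%:E < 1)%E by [].
  rewrite !lte_fin tau_gt0; split=> //.
  (* Otherwise the return probabilities would agree at [d] as well as below, contradicting
     [ncos]. *)
  have k0 : kappa_lim R e x y d != 0.
    apply/negP; rewrite mulf_eq0 invr_eq0 (gt_eqF b0) orbF subr_eq0 => /eqP E.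
    apply: ncos => k.
    rewrite leq_eqVlt => /predU1P[->|kd]; first by rewrite (PR_x_nadj R Hg Hc Hxy) (PR_y_nadj R Hg Hc Hxy).
    by apply: cosp; rewrite -ltnS prednK// (dist_gt0 Hxy Hd).
  have : 0 < kappa_lim R e x y d ^+ 2 by rewrite lt_neqAle sqr_ge0 andbT eq_sym expf_neq0.
  by move=> ?; rewrite /tau ltr_pdivrMr; lra.
- by move=> ncos; rewrite (no_tunneling Hg Hc Hxy Hd ncos).
- move=> cosp; have [_ Th] := tunnel cosp; split=> //.
  exact: tunneling_time_Theta_sym.
Qed.
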